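(* Let $(w_{s,t})_{(s,t)\in\Delta(I)}$ be a family in $\mathfrak{BF}$ such that $w_{s,s}=\mathrm{id}_{\mathbb{H}}$ for any $s\in I$, and $w_{s,u}=w_{t,u}\circ w_{s,t}$ for any $s,t,u\in I$ with $s\le t\le u$. Suppose that the following assertions hold: (i) $w_{0,t}(0)=0$ for all $t\in I$; (ii) $w_{0,t}'(0)$ and $w_{0,t}''(0)$ are finite for all $t\in I$; (iii) the mappings $I\ni t\mapsto w'_{0,t}(0)$ and $I\ni t\mapsto w''_{0,t}(0)$ are of class $AC_{\mathrm{loc}}(I)$. Then $(w_{s,t})$ is an absolutely continuous evolution family (in $\mathbb{H}$ over $I$).
   Context: $\mathbb{H}:=\{z\in\mathbb{C}\colon\operatorname{Re}z>0\}$; $\mathsf{Hol}(D,E)$ is the set of holomorphic functions $f$ in $D$ with $f(D)\subset E$. A Bernstein function is a non-negative $C^\infty$ function $f$ on $(0,+\infty)$ such that $(-1)^{n+1}f^{(n)}(x)\ge0$ for all $x>0$ and all $n\in\mathbb{N}=\{1,2,\dots\}$. $\mathfrak{BF}$ denotes the class of all $v\in\mathsf{Hol}(\mathbb{H},\mathbb{C})$ such that $v|_{(0,+\infty)}$ is a Bernstein function that is not identically zero; one has $\mathfrak{BF}\subset\mathsf{Hol}(\mathbb{H},\mathbb{H})$. For $f\in\mathfrak{BF}$, $f(0):=\lim_{\mathbb{R}\ni x\to0^+}f(x)\in[0,+\infty)$ and $f^{(n)}(0):=\lim_{\mathbb{R}\ni x\to0^+}f^{(n)}(x)$, $n\in\mathbb{N}$;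 these limits exist (finite or infinite for $n\ge1$) by monotonicity. $I\subset\mathbb{R}$ is an interval of the form $[0,T]$ with $T\in(0,+\infty)$ or $[0,T)$ with $T\in(0,+\infty]$; $\Delta(I):=\{(s,t)\colon s,t\in I,\ s\le t\}$; $AC_{\mathrm{loc}}(I)$ is the class of functions on $I$ absolutely continuous on each compact subinterval of $I$; $L^1_{\mathrm{loc}}(I)$ is the class of measurable functions on $I$ integrable on each compact subinterval. An absolutely continuous evolution family in $\mathbb{H}$ over $I$ is a family $(w_{s,t})_{(s,t)\in\Delta(I)}\subset\mathsf{Hol}(\mathbb{H},\mathbb{H})$ such that: EF1: $w_{s,s}=\mathrm{id}_{\mathbb{H}}$ for all $s\in I$; EF2: $w_{s,u}=w_{t,u}\circ w_{s,t}$ whenever $s\le t\le u$ in $I$; EF3: for each $z\in\mathbb{H}$ there is a non-negative $f_z\in L^1_{\mathrm{loc}}(I)$ with $|w_{s,u}(z)-w_{s,t}(z)|\le\int_t^u f_z(r)\,\mathrm{d}r$ whenever $s\le t\le u$ in $I$. *)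

(* Defs.v *)
From HB Require Import structures.
From mathcomp Require Import all_boot all_order all_algebra.
From mathcomp Require Import all_classical all_reals all_analysis.
From mathcomp Require Export complex.
Set Implicit Arguments.
Unset Strict Implicit.
Unset Printing Implicit Defensive.
Import Order.TTheory GRing.Theory Num.Theory.
Import numFieldNormedType.Exports.
Local Open Scope ring_scope.
Local Open Scope classical_set_scope.
Local Open Scope complex_scope.

Definition half_plane (R : realType) : set R[i] := [set z | 0 < complex.Re z].

(* Derivability is taken over the field [R[i]], i.e. it is complex
   differentiability.  The functions are total; their values outside [D] are
   irrelevant when [D] is open. *)
Definition Hol (R : realType) (D E : set R[i]) : set (R[i] -> R[i]) :=
  [set f | (forall z, D z -> derivable (f : R[i]^o -> R[i]^o) z 1) /\
           (forall z, D z -> E (f z))].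

Definition bernstein (R : realType) (g : R -> R) : Prop :=
  [/\ forall x : R, 0 < x -> 0 <= g x,
      forall (n : nat) (x : R), 0 < x -> derivable g^`(n)%classic x 1 &
      forall (n : nat) (x : R), (0 < n)%N -> 0 < x ->
        0 <= (- 1) ^+ n.+1 * g^`(n)%classic x].

(* Only meaningful for functions that are real-valued on the positive axis. *)
Definition real_trace (R : realType) (v : R[i] -> R[i]) : R -> R :=
  fun x => complex.Re (v x%:C).

Definition BF (R : realType) : set (R[i] -> R[i]) :=
  [set v | [/\ Hol (@half_plane R) setT v,
               forall x : R, 0 < x -> complex.Im (v x%:C) = 0,
               bernstein (real_trace v) &
               exists2 x : R, 0 < x & v x%:C != 0]].

(* [f^(n)(0)], as an extended real; for [f] in [BF] the limit exists by
   monotonicity. *)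
Definition deriv_at0 (R : realType) (n : nat) (f : R[i] -> R[i]) : \bar R :=
  lim (((real_trace f)^`(n)%classic x)%:E @[x --> 0^'+]).

Definition time_interval (R : realType) (I : set R) : Prop :=
  (exists2 T : R, 0 < T & (I = `[0, T] \/ I = `[0, T[)) \/ I = `[0, +oo[.

Definition Delta (R : realType) (I : set R) : set (R * R) :=
  [set p | [/\ I p.1, I p.2 & p.1 <= p.2]].

Definition abs_continuous (R : realType) (a b : R) (f : R -> R) : Prop :=
  forall e : R, 0 < e -> exists2 d : R, 0 < d &
    forall (n : nat) (x y : 'I_n -> R),
      (forall i, [/\ a <= x i, x i < y i & y i <= b]) ->
      trivIset setT (fun i => `]x i, y i[) ->
      \sum_(i < n) (y i - x i) < d ->
      \sum_(i < n) `|f (y i) - f (x i)| < e.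

Definition AC_loc (R : realType) (I : set R) (f : R -> R) : Prop :=
  forall a b : R, a <= b -> `[a, b] `<=` I -> abs_continuous a b f.

(* The library's [locally_integrable] requires an open domain, which [I] need
   not be. *)
Definition L1_loc (R : realType) (I : set R) (f : R -> R) : Prop :=
  measurable_fun I f /\
  forall a b : R, a <= b -> `[a, b] `<=` I ->
    (@lebesgue_measure R).-integrable `[a, b] (EFin \o f).

Definition ac_evolution_family (R : realType) (I : set R)
    (w : R -> R -> R[i] -> R[i]) : Prop :=
  [/\ forall s t, Delta I (s, t) -> Hol (@half_plane R) (@half_plane R) (w s t),
      forall s, I s -> forall z, half_plane z -> w s s z = z,
      forall s t u, I s -> I t -> I u -> s <= t -> t <= u ->
        forall z, half_plane z -> w s u z = w t u (w s t z) &
      forall z, half_plane z ->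
        exists f : R -> R,
          [/\ L1_loc I f, forall r, I r -> 0 <= f r &
              forall s t u, I s -> I t -> I u -> s <= t -> t <= u ->
                `|w s u z - w s t z| <=
                  (\int[@lebesgue_measure R]_(r in `[t, u]) f r)%:C]].

(* Main.v *)
From HB Require Import structures.
Require Import Defs.
From mathcomp Require Import all_boot all_order all_algebra.
From mathcomp Require Import all_classical all_reals all_analysis.
From mathcomp Require Import measurable_realfun ring lra.
Set Implicit Arguments.
Unset Strict Implicit.
Unset Printing Implicit Defensive.
Import Order.TTheory GRing.Theory Num.Theory.
Import numFieldNormedType.Exports.
Local Open Scope ring_scope.
Local Open Scope classical_set_scope.

(** Idea.  Let f be the trace on (0, +oo) of a function v in BF.  The estimates
    that the Levy-Khintchine representation would give are obtained from Taylor
    expansions instead.  For x0 > 0 the function r |-> - f (x0 - r) has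
    nonnegative derivatives, so its Taylor series at 0 converges on [0, x0)
    (Bernstein); by a two-constants argument, which needs the maximum modulus
    principle and hence Goursat's theorem for functions that are merely
    complex differentiable, the Taylor polynomials also converge to v off the
    real axis.  As the coefficients are nonnegative, the bounds
      Re (v z) >= f (x0 - |x0 - z|),
      |v z - f e| <= f'(e) |z - e|,
      |v z - f e - f'(e) (z - e)| <= - f''(e) |z - e|^2 / 2
    for 0 < e < Re z reduce to inequalities between monomials.

    Write a(t) and b(t) for w_{0,t}'(0) and w_{0,t}''(0).  Applying these bounds
    to v = w_{t,u} with e = w_{0,t}(x), x -> 0+, and the chain rule gives
      |w_{t,u}(z) - a(u)/a(t) z| <= |b(u) - a(u)/a(t) b(t)| / a(t)^2 |z|^2 / 2,
    so on compact time intervals |w_{s,u}(z) - w_{s,t}(z)| is at most a constant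
    times |a(u) - a(t)| + |b(u) - b(t)|.  Finally the increments of an
    absolutely continuous function are dominated by the integral of the
    Radon-Nikodym density of its total variation. *)

(** * Goursat's theorem *)

(** Boundary values at 0 are assumed for the maps [w 0 t] alone, so [w t u] cannot be expanded at 0
    itself. The moving base point w_{0,t}(x) lies inside the domain and there the first two
    derivatives of [w t u] are quotients of known quantities, which have limits as x tends to 0.
    Both a and b are needed: increments of a control the linear part of w_{t,u}, those of b its
    deviation from a linear map. On real segments the Taylor polynomials about x0 are close to v,
    but off the axis nothing better than a uniform bound is available beforehand. Hence the disc
    with diameter (0, x0): a half of a slightly smaller concentric disc is bounded by a diameter,
    where the error is small, and an arc, where it is bounded. These discs exhaust the half-plane as
    x0 grows. Constants and densities depend on the compact interval [0, b]; on a half-open I the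
    densities belonging to an exhausting sequence are pasted together. *)

Lemma geometric_lt (R : realType) (C q r : R) : `|q| < 1 -> 0 < r ->
  exists N, forall n, (N <= n)%N -> `|C * q ^+ n| < r.
Proof.
move=> q1 r0; have /cvgrPdist_lt := cvg_geometric C q1.
move=> /(_ r r0)[N _ hN]; exists N => n /hN /=.
by rewrite sub0r normrN.
Qed.

(** * Additive functions of rectangles and repeated bisection *)

Section RectangleFunction.
Variables (R : realType) (E : R -> R -> R -> R -> R) (a b c d : R).
Hypotheses (hab : a <= b) (hcd : c <= d).
Hypothesis Ex : forall x1 x x2 y1 y2, a <= x1 -> x1 <= x -> x <= x2 -> x2 <= b ->
  c <= y1 -> y1 <= y2 -> y2 <= d ->
  E x1 x2 y1 y2 = E x1 x y1 y2 + E x x2 y1 y2.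
Hypothesis Ey : forall x1 x2 y1 y y2, a <= x1 -> x1 <= x2 -> x2 <= b ->
  c <= y1 -> y1 <= y -> y <= y2 -> y2 <= d ->
  E x1 x2 y1 y2 = E x1 x2 y1 y + E x1 x2 y y2.
Hypothesis Eloc : forall x y, a <= x <= b -> c <= y <= d ->
  forall e, 0 < e -> exists2 r, 0 < r & forall x1 x2 y1 y2,
    a <= x1 -> x1 <= x <= x2 -> x2 <= b -> c <= y1 -> y1 <= y <= y2 -> y2 <= d ->
    (x2 - x1) + (y2 - y1) < r ->
    `|E x1 x2 y1 y2| <= e * ((x2 - x1) + (y2 - y1)) ^+ 2.

(** The squared half-perimeter is the right scale: quartering divides it by four, so a bad rectangle
    has a quarter that is bad for the same [e]. *)
Let bad e (q : R * R * (R * R)) :=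
  e * ((q.1.2 - q.1.1) + (q.2.2 - q.2.1)) ^+ 2 < `|E q.1.1 q.1.2 q.2.1 q.2.2|.
Let mid (p : R * R) := (p.1 + p.2) / 2.
Let quarter (i j : bool) (q : R * R * (R * R)) : R * R * (R * R) :=
  ((if i then (q.1.1, mid q.1) else (mid q.1, q.1.2)),
   (if j then (q.2.1, mid q.2) else (mid q.2, q.2.2))).
(** The fourth quarter is the default; [bad_step] shows that it is bad when the other three are
    not. *)
Let step e q :=
  if bad e (quarter true true q) then quarter true true q else
  if bad e (quarter true false q) then quarter true false q else
  if bad e (quarter false true q) then quarter false true q else
  quarter false false q.
Let inside (q : R * R * (R * R)) :=
  [/\ a <= q.1.1, q.1.1 <= q.1.2 & q.1.2 <= b] /\
  [/\ c <= q.2.1, q.2.1 <= q.2.2 & q.2.2 <= d].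

Let step_quarter e q : exists i j, step e q = quarter i j q.
Proof.
rewrite /step; case: ifP => _; first by exists true, true.
case: ifP => _; first by exists true, false.
by case: ifP => _; [exists false, true|exists false, false].
Qed.

Let inside_quarter i j q : inside q -> inside (quarter i j q).
Proof.
case: q => -[x1 x2] [y1 y2] [] /= [? ? ?] [? ? ?].
by split; [case: i|case: j]; rewrite /quarter /mid/=; split; lra.
Qed.

Let bad_step e q : inside q -> bad e q -> bad e (step e q).
Proof.
case: q => -[x1 x2] [y1 y2] [] /= [ax1 x12 x2b] [cy1 y12 y2d].
rewrite /step; do 3 (case: ifPn => //; rewrite /bad -leNgt /=).
rewrite /quarter /mid/= => h3 h2 h1 hb; rewrite ltNge; apply/negP => h4; move: hb.
rewrite ltNge => /negP; apply.
set xm := (x1 + x2) / 2; set ym := (y1 + y2) / 2.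
rewrite -/xm -/ym in h1 h2 h3 h4.
have hxm : xm = (x1 + x2) / 2 by [].
have hym : ym = (y1 + y2) / 2 by [].
rewrite (@Ex _ xm)//; [|lra..].
rewrite (@Ey x1 xm _ ym)//; [|lra..].
rewrite (@Ey xm x2 _ ym)//; [|lra..].
apply: le_trans (ler_normD _ _) _.
apply: le_trans (lerD (ler_normD _ _) (ler_normD _ _)) _.
apply: le_trans (lerD (lerD h1 h2) (lerD h3 h4)) _.
(* An equality: half-perimeters are halved, so the four bounds add up exactly to the bound for the
   whole rectangle. *)
by rewrite hxm hym le_eqVlt; apply/orP; left; apply/eqP; field.
Qed.

(** Goursat's bisection: nested bad rectangles shrink to a point, and [Eloc] makes every small
    rectangle around this point good. *)
Lemma additive_rectangle_eq0 : E a b c d = 0.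
Proof.
apply/eqP; apply: contrapT => /negP E0.
have hE : 0 < `|E a b c d| by rewrite normr_gt0.
pose L := ((b - a) + (d - c)) ^+ 2.
have L0 : 0 <= L by exact: sqr_ge0.
(* Then e L < |E a b c d|, so the initial rectangle is bad; the + 1 keeps the denominator positive
   for a degenerate rectangle. *)
pose e := `|E a b c d| / (2 * (L + 1)).
have e0 : 0 < e by rewrite divr_gt0// mulr_gt0//; lra.
pose q n := iter n (step e) ((a, b), (c, d)).
have qP n : [/\ inside (q n), bad e (q n),
  (q n).1.2 - (q n).1.1 = (b - a) / 2 ^+ n &
  (q n).2.2 - (q n).2.1 = (d - c) / 2 ^+ n].
  elim: n => [|n [i1 b1 w1 h1]].
    split; rewrite /= ?expr0 ?divr1//.
    rewrite /bad /= -/L /e mulrAC ltr_pdivrMr; last by lra.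
    by rewrite ltr_pM2l//; lra.
  rewrite /q iterS -/(q n).
  have [i [j sq]] := step_quarter e (q n).
  split.
  - by rewrite sq; exact: inside_quarter.
  - exact: bad_step.
  - rewrite sq exprS invfM mulrCA -w1.
    by case: i {sq}; rewrite /quarter /mid/=; field.
  - rewrite sq exprS invfM mulrCA -h1.
    by case: j {sq}; rewrite /quarter /mid/=; field.
have mono n : [/\ (q n).1.1 <= (q n.+1).1.1, (q n.+1).1.2 <= (q n).1.2,
    (q n).2.1 <= (q n.+1).2.1 & (q n.+1).2.2 <= (q n).2.2].
  have [[[? ? ?] [? ? ?]] _ _ _] := qP n.
  rewrite /q iterS -/(q n); have [i [j ->]] := step_quarter e (q n).
  by case: i; case: j; rewrite /quarter /mid/=; split; lra.
have monoD n m : [/\ (q n).1.1 <= (q (n + m)%N).1.1, (q (n + m)%N).1.2 <= (q n).1.2,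
    (q n).2.1 <= (q (n + m)%N).2.1 & (q (n + m)%N).2.2 <= (q n).2.2].
  elim: m => [|m [? ? ? ?]]; first by rewrite addn0.
  by rewrite addnS; have [? ? ? ?] := mono (n + m)%N; split; lra.
(* Left and lower ends increase with n, so their suprema are the coordinates of a point common to
   all the rectangles. *)
pose X := [set (q n).1.1 | n in setT]; pose Y := [set (q n).2.1 | n in setT].
have Xub n : ubound X (q n).1.2.
  move=> _ [m _ <-].
  have [H _ _ _] := monoD m n; have [_ ? _ _] := monoD n m.
  have [[[? ? ?] _] _ _ _] := qP (n + m)%N.
  by rewrite addnC in H; lra.
have Yub n : ubound Y (q n).2.2.
  move=> _ [m _ <-].
  have [_ _ H _] := monoD m n; have [_ _ _ ?] := monoD n m.
  have [[_ [? ? ?]] _ _ _] := qP (n + m)%N.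
  by rewrite addnC in H; lra.
have hX n : (q n).1.1 <= sup X <= (q n).1.2.
  apply/andP; split; last by apply: ge_sup => //; exists (q 0%N).1.1, 0%N.
  by apply: ub_le_sup; [exists (q 0%N).1.2|exists n].
have hY n : (q n).2.1 <= sup Y <= (q n).2.2.
  apply/andP; split; last by apply: ge_sup => //; exists (q 0%N).2.1, 0%N.
  by apply: ub_le_sup; [exists (q 0%N).2.2|exists n].
have [r r0 hr] := @Eloc (sup X) (sup Y) (hX 0%N) (hY 0%N) e e0.
have [n hn] : exists n, ((b - a) + (d - c)) / 2 ^+ n < r.
  have h2 : `|2^-1 : R| < 1 by rewrite ger0_norm//; lra.
  have [N hN] := geometric_lt ((b - a) + (d - c)) h2 r0.
  exists N; have := hN N (leqnn N); rewrite exprVn.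
  by apply: le_lt_trans; exact: ler_norm.
have [[[? ? ?] [? ? ?]] hb w1 w2] := qP n.
move: hb; rewrite /bad ltNge => /negP; apply.
apply: hr => //.
by rewrite w1 w2 -mulrDl.
Qed.

End RectangleFunction.

(** * Integrals of continuous functions over segments *)

Section SegmentIntegral.
Variable R : realType.
Implicit Types (f g : R -> R) (a b c e K : R).
Notation mu := (@lebesgue_measure R).
Notation J f a b := (\int[mu]_(x in `[a, b]) f x).

Definition eps_cont a b f := forall x, a <= x <= b -> forall e, 0 < e ->
  exists2 d : R, 0 < d & forall y, a <= y <= b -> `|y - x| < d -> `|f y - f x| < e.

Lemma eps_contW a b a' b' f : a <= a' -> b' <= b ->
  eps_cont a b f -> eps_cont a' b' f.
Proof.
move=> aa bb cf x hx e e0; have [|d d0 hd] := cf x _ e e0; first lra.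
by exists d => // y hy; apply: hd; lra.
Qed.

Lemma eps_cont_within a b f : eps_cont a b f -> {within `[a, b], continuous f}.
Proof.
move=> cf; apply/subspace_continuousP => x.
rewrite /= in_itv/= => hx; apply/cvgrPdist_lt => e e0.
have [d d0 hd] := cf x hx e e0.
rewrite near_withinE; apply/nbhs_ballP; exists d => //= y xy yab.
rewrite distrC; apply: hd; first by move: yab; rewrite /= in_itv.
by rewrite distrC.
Qed.

Lemma eps_cont_integrable a b f : eps_cont a b f ->
  mu.-integrable `[a, b] (EFin \o f).
Proof.
move=> /eps_cont_within cf.
by apply: continuous_compact_integrable => //; exact: segment_compact.
Qed.

Lemma segment_integral_split a c b f : a <= c -> c <= b -> eps_cont a b f ->
  J f a b = J f a c + J f c b.
Proof.
move=> ac cb cf; have := @Rintegral_itvB R f (BLeft a) (BRight b) c.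
rewrite !bnd_simp => /(_ (eps_cont_integrable cf) ac cb) h.
have := eps_cont_integrable (eps_contW ac (lexx b) cf) => i2.
have <- : \int[mu]_(x in `]c, b]) f x = J f c b.
  apply: Rintegral_itv_obnd_cbnd; apply: integrableS i2 => //.
  by apply: subset_itvr; rewrite bnd_simp.
by rewrite -h addrC subrK.
Qed.

Lemma segment_integral_cst a b K : a <= b -> J (fun=> K) a b = K * (b - a).
Proof.
move=> ab; rewrite Rintegral_cst//= lebesgue_measure_itv/= lte_fin.
case: ltP => // ba; rewrite (le_anti (_ : b <= a <= b)) ?ba//.
by rewrite subrr mulr0.
Qed.

Lemma eps_cont_cst a b K : eps_cont a b (fun=> K).
Proof. by move=> x _ e e0; exists 1 => // y _ _; rewrite subrr normr0. Qed.

Lemma eps_contB a b f g : eps_cont a b f -> eps_cont a b g ->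
  eps_cont a b (fun x => f x - g x).
Proof.
move=> cf cg x hx e e0.
have e20 : 0 < e / 2 by lra.
have [d1 d10 h1] := cf x hx _ e20; have [d2 d20 h2] := cg x hx _ e20.
exists (Num.min d1 d2); first by rewrite lt_min d10.
move=> y hy; rewrite lt_min => /andP[y1 y2].
have -> : f y - g y - (f x - g x) = (f y - f x) - (g y - g x) by ring.
apply: le_lt_trans (ler_normB _ _) _.
by have := h1 y hy y1; have := h2 y hy y2; lra.
Qed.

Lemma segment_integral_le a b f g : eps_cont a b f -> eps_cont a b g ->
  (forall x, a <= x <= b -> f x <= g x) -> J f a b <= J g a b.
Proof.
by move=> cf cg fg; apply: le_Rintegral => //; exact: eps_cont_integrable.
Qed.

Lemma segment_integralB a b f g : eps_cont a b f -> eps_cont a b g ->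
  J (fun x => f x - g x) a b = J f a b - J g a b.
Proof. by move=> cf cg; apply: RintegralB => //; exact: eps_cont_integrable. Qed.

Lemma segment_integral_near a b f K e : a <= b -> eps_cont a b f ->
  (forall x, a <= x <= b -> `|f x - K| <= e) ->
  `|J f a b - K * (b - a)| <= e * (b - a).
Proof.
move=> ab cf fK; rewrite ler_distl -mulrBl -mulrDl -!segment_integral_cst//.
apply/andP; split; apply: segment_integral_le => //; try exact: eps_cont_cst.
  by move=> x /fK; rewrite ler_distl => /andP[].
by move=> x /fK; rewrite ler_distl => /andP[].
Qed.

(** A positive value at [a] would keep f above f a / 2 on some [a, r], which alone gives a positive
    integral. The left endpoint later stands for the angle 0 on a circle. *)
Lemma segment_integral_le0_eq a b f : a < b -> eps_cont a b f ->
  (forall x, a <= x <= b -> 0 <= f x) -> J f a b <= 0 -> f a = 0.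
Proof.
move=> ab cf f0 If; apply/eqP; apply: contrapT => /negP fa.
have fa0 : 0 < f a by rewrite lt_neqAle eq_sym fa f0// lexx ltW.
have fa20 : 0 < f a / 2 by lra.
have [|d d0 hd] := cf a _ _ fa20; first by rewrite lexx ltW.
pose r := Num.min b (a + d / 2).
have ar : a < r by rewrite lt_min ab; lra.
have rb : r <= b by rewrite ge_min lexx.
have rd : r <= a + d / 2 by rewrite ge_min lexx orbT.
have car : eps_cont a r f by exact: eps_contW cf.
have crb : eps_cont r b f by apply: eps_contW cf => //; exact: ltW.
move: If; rewrite (segment_integral_split (ltW ar) rb cf) leNgt => /negP; apply.
apply: (@lt_le_trans _ _ (f a / 2 * (r - a) + 0 * (b - r))).
  by rewrite mul0r addr0 mulr_gt0// subr_gt0.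
rewrite -!segment_integral_cst//; last exact: ltW.
apply: lerD; apply: segment_integral_le => //; try exact: eps_cont_cst.
  move=> x hx; have /ltr_normlP[] : `|f x - f a| < f a / 2; last lra.
  by apply: hd; [lra|rewrite ger0_norm; lra].
by move=> x hx; apply: f0; lra.
Qed.

End SegmentIntegral.
Notation segment_integral f a b :=
  (\int[lebesgue_measure]_(x in `[a, b]) f x).

Section ComplexModulus.
Variable R : realType.
Implicit Types (z w : R[i]) (x y : R).
Local Open Scope complex_scope.

(** The norm of [R[i]] takes its values in [R[i]]; [cmod] is the same number in [R], within reach of
    [lra]. *)
Definition cmod z : R := complex.Re `|z|.

Lemma normcE z : `|z| = (cmod z)%:C.
Proof. by rewrite /cmod normc_def. Qed.

Lemma cmodE z : cmod z = Num.sqrt (complex.Re z ^+ 2 + complex.Im z ^+ 2).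
Proof. by rewrite /cmod normc_def. Qed.

Lemma cmod_ge0 z : 0 <= cmod z.
Proof. by rewrite cmodE sqrtr_ge0. Qed.

Lemma cmod_eq0 z : (cmod z == 0) = (z == 0).
Proof. by rewrite -(normr_eq0 z) normcE -(inj_eq (@complexI R)). Qed.

Lemma cmod0 : cmod 0 = 0. Proof. by apply/eqP; rewrite cmod_eq0. Qed.

Lemma cmodM z w : cmod (z * w) = cmod z * cmod w.
Proof. by apply: (@complexI R); rewrite rmorphM/= -!normcE normrM. Qed.

Lemma cmodX z n : cmod (z ^+ n) = cmod z ^+ n.
Proof. by apply: (@complexI R); rewrite rmorphXn/= -!normcE normrX. Qed.

Lemma cmodV z : cmod z^-1 = (cmod z)^-1.
Proof. by apply: (@complexI R); rewrite fmorphV/= -!normcE normfV. Qed.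

Lemma cmodN z : cmod (- z) = cmod z.
Proof. by rewrite /cmod normrN. Qed.

Lemma cmodB z w : cmod (z - w) = cmod (w - z).
Proof. by rewrite /cmod distrC. Qed.

Lemma cmodD z w : cmod (z + w) <= cmod z + cmod w.
Proof. by rewrite -lecR rmorphD/= -!normcE ler_normD. Qed.

Lemma cmod_leB z w : cmod z - cmod w <= cmod (z - w).
Proof. by rewrite -lecR rmorphB/= -!normcE lerB_dist. Qed.

Lemma cmod_sum n (F : 'I_n -> R[i]) : cmod (\sum_i F i) <= \sum_i cmod (F i).
Proof.
elim/big_ind2: _ => //; first by rewrite cmod0.
by move=> z x w y hz hw; apply: le_trans (cmodD _ _) _; exact: lerD.
Qed.

Lemma cmod_real x : cmod x%:C = `|x|.
Proof. by rewrite cmodE/= expr0n addr0 sqrtr_sqr. Qed.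

Lemma cmod_Re z : `|complex.Re z| <= cmod z.
Proof. by rewrite cmodE -sqrtr_sqr ler_wsqrtr// lerDl sqr_ge0. Qed.

Lemma cmod_Im z : `|complex.Im z| <= cmod z.
Proof. by rewrite cmodE -sqrtr_sqr ler_wsqrtr// lerDr sqr_ge0. Qed.

Lemma cmod_le_ReIm z : cmod z <= `|complex.Re z| + `|complex.Im z|.
Proof.
rewrite cmodE -[leRHS]ger0_norm ?addr_ge0// -sqrtr_sqr ler_wsqrtr//.
rewrite sqrrD !real_normK ?num_real// addrAC lerDl.
by rewrite mulrn_wge0 ?mulr_ge0.
Qed.

Lemma cmod_sqr z : cmod z ^+ 2 = complex.Re z ^+ 2 + complex.Im z ^+ 2.
Proof. by rewrite cmodE sqr_sqrtr// addr_ge0 ?sqr_ge0. Qed.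

Lemma ReB z w : complex.Re (z - w) = complex.Re z - complex.Re w.
Proof. by case: z; case: w. Qed.
Lemma ImB z w : complex.Im (z - w) = complex.Im z - complex.Im w.
Proof. by case: z; case: w. Qed.

Lemma complex_eqP z w :
  complex.Re z = complex.Re w -> complex.Im z = complex.Im w -> z = w.
Proof. by case: z w => [a b] [c d] /= -> ->. Qed.

End ComplexModulus.

Section ComplexDifferentiability.
Variable R : realType.
Implicit Types (f g k : R[i] -> R[i]) (z w p : R[i]) (e r a b c d : R).
Local Open Scope complex_scope.

(** Division-free complex differentiability with derivative L; the weak inequality also covers w =
    z. *)
Definition cdiff f z := exists L, forall e, 0 < e -> exists2 r : R, 0 < r &
  forall w, cmod (w - z) < r ->
    cmod (f w - f z - L * (w - z)) <= e * cmod (w - z).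

Lemma derivable_cdiff f z :
  derivable (f : R[i]^o -> R[i]^o) z 1 -> cdiff f z.
Proof.
move=> /cvg_ex[/= L /cvgrPdist_lt fL]; exists L => e e0.
have /fL : 0 < e%:C by rewrite ltcR.
rewrite near_withinE => /nbhs_ballP[d /= d0 hd].
(* The radius of a ball in [R[i]] is an element of [R[i]]; being positive, it is real. *)
have dE : d = (complex.Re d)%:C.
  by move: d0; rewrite ltcE => /andP[/eqP d1 _]; case: d d1 {hd} => ? ? /= ->.
exists (complex.Re d); first by rewrite -ltcR -dE.
move=> w wd; have [->|wz] := eqVneq w z.
  by rewrite !subrr mulr0 subr0 cmod0 mulr0.
have wz0 : w - z != 0 by rewrite subr_eq0.
have := hd (w - z); rewrite -ball_normE/= sub0r normrN normcE dE ltcR => /(_ wd wz0).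
rewrite /= /GRing.scale/= mulr1 subrK distrC normcE ltcR => h.
have -> : f w - f z - L * (w - z) = ((w - z)^-1 * (f w - f z) - L) * (w - z).
  by rewrite mulrBl mulrAC mulVf// mul1r.
by rewrite cmodM ler_wpM2r ?cmod_ge0// ltW.
Qed.

Lemma cdiff_lipschitz f z : cdiff f z ->
  exists2 M : R, 0 < M & exists2 r : R, 0 < r &
    forall w, cmod (w - z) < r -> cmod (f w - f z) <= M * cmod (w - z).
Proof.
move=> [L /(_ 1 ltr01)[r r0 hr]]; exists (1 + cmod L).
  by have := cmod_ge0 L; lra.
exists r => // w /hr h; rewrite mulrDl -cmodM.
rewrite -[f w - f z](subrK (L * (w - z))).
by apply: le_trans (cmodD _ _) _; rewrite lerD2r.
Qed.

Lemma cdiff_cont f z e : cdiff f z -> 0 < e -> exists2 r : R, 0 < r &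
  forall w, cmod (w - z) < r -> cmod (f w - f z) < e.
Proof.
move=> /cdiff_lipschitz[M M0 [r r0 hr]] e0.
exists (Num.min r (e / M)); first by rewrite lt_min r0 divr_gt0.
move=> w; rewrite lt_min => /andP[/hr h1 h2]; apply: le_lt_trans h1 _.
by rewrite mulrC -ltr_pdivlMr.
Qed.

Lemma cdiff_comp f g z : cdiff g z -> cdiff f (g z) -> cdiff (f \o g) z.
Proof.
move=> dg [L2 df]; have [M M0 [r0 r00 hM]] := cdiff_lipschitz dg.
case: dg => L1 dg; exists (L2 * L1) => e e0.
have e10 : 0 < e / (2 * M) by rewrite divr_gt0// mulr_gt0.
have [r1 r10 h1] := df _ e10.
have e20 : 0 < e / (2 * (cmod L2 + 1)).
  by rewrite divr_gt0// mulr_gt0//; have := cmod_ge0 L2; lra.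
have [r2 r20 h2] := dg _ e20.
exists (Num.min r0 (Num.min r2 (r1 / M))).
  by rewrite !lt_min r00 r20 divr_gt0.
move=> w; rewrite !lt_min => /and3P[/hM hw0 /h2 hw2 hw1].
have /h1 hf : cmod (g w - g z) < r1.
  by apply: le_lt_trans hw0 _; rewrite mulrC -ltr_pdivlMr.
have -> : (f \o g) w - (f \o g) z - L2 * L1 * (w - z) =
    (f (g w) - f (g z) - L2 * (g w - g z)) +
    L2 * (g w - g z - L1 * (w - z)) by rewrite /=; ring.
apply: le_trans (cmodD _ _) _; rewrite cmodM.
have n0 := cmod_ge0 (w - z); have L20 := cmod_ge0 L2.
have : e / (2 * M) * cmod (g w - g z) <= e / 2 * cmod (w - z).
  have -> : e / 2 * cmod (w - z) = e / (2 * M) * (M * cmod (w - z)).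
    by field; rewrite gt_eqF.
  by rewrite ler_pM2l.
have : cmod L2 * cmod (g w - g z - L1 * (w - z)) <= e / 2 * cmod (w - z).
  have -> : e / 2 * cmod (w - z) =
      (cmod L2 + 1) * (e / (2 * (cmod L2 + 1)) * cmod (w - z)).
    by field; rewrite gt_eqF//; lra.
  by rewrite ler_pM ?cmod_ge0//; lra.
by move: hf; lra.
Qed.

(** The left-hand side is the imaginary part of the integral of g dz along the positively oriented
    boundary. Differentiability makes it small compared with the squared perimeter, so bisection
    applies. The imaginary part is the one that contains Re g on the vertical sides, which become
    circles under the exponential. *)
Lemma goursat g a b c d : a <= b -> c <= d ->
  (forall x y, a <= x <= b -> c <= y <= d -> cdiff g (x +i* y)) ->
  segment_integral (fun y => complex.Re (g (b +i* y))) c d -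
  segment_integral (fun y => complex.Re (g (a +i* y))) c d -
  (segment_integral (fun x => complex.Im (g (x +i* d))) a b -
   segment_integral (fun x => complex.Im (g (x +i* c))) a b) = 0.
Proof.
move=> ab cd dg.
have cRe x : a <= x <= b -> eps_cont c d (fun y => complex.Re (g (x +i* y))).
  move=> hx y hy e e0; have [r r0 hr] := cdiff_cont (dg x y hx hy) e0.
  exists r => // y' _ yy; rewrite -ReB; apply: le_lt_trans (cmod_Re _) _.
  by apply: hr; rewrite cmodE/= subrr expr0n add0r sqrtr_sqr.
have cIm y : c <= y <= d -> eps_cont a b (fun x => complex.Im (g (x +i* y))).
  move=> hy x hx e e0; have [r r0 hr] := cdiff_cont (dg x y hx hy) e0.
  exists r => // x' _ xx; rewrite -ImB; apply: le_lt_trans (cmod_Im _) _.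
  by apply: hr; rewrite cmodE/= subrr expr0n addr0 sqrtr_sqr.
apply: (@additive_rectangle_eq0 R (fun x1 x2 y1 y2 =>
  segment_integral (fun y => complex.Re (g (x2 +i* y))) y1 y2 -
  segment_integral (fun y => complex.Re (g (x1 +i* y))) y1 y2 -
  (segment_integral (fun x => complex.Im (g (x +i* y2))) x1 x2 -
   segment_integral (fun x => complex.Im (g (x +i* y1))) x1 x2))) => //.
- move=> x1 x x2 y1 y2 ? ? ? ? ? ? ?.
  rewrite (@segment_integral_split R x1 x x2 (fun x => complex.Im (g (x +i* y2))))//; last first.
    by apply: (eps_contW _ _ (cIm y2 _)) => //; lra.
  rewrite (@segment_integral_split R x1 x x2 (fun x => complex.Im (g (x +i* y1))))//; last first.
    by apply: (eps_contW _ _ (cIm y1 _)) => //; lra.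
  by ring.
- move=> x1 x2 y1 y y2 ? ? ? ? ? ? ?.
  rewrite (@segment_integral_split R y1 y y2 (fun y => complex.Re (g (x1 +i* y))))//; last first.
    by apply: (eps_contW _ _ (cRe x1 _)) => //; lra.
  rewrite (@segment_integral_split R y1 y y2 (fun y => complex.Re (g (x2 +i* y))))//; last first.
    by apply: (eps_contW _ _ (cRe x2 _)) => //; lra.
  by ring.
move=> x y hx hy e e0; have [L hL] := dg x y hx hy.
have e20 : 0 < e / 2 by lra.
have [r r0 hr] := hL _ e20; exists r => // x1 x2 y1 y2 ax /andP[x1x xx2] xb.
move=> cy /andP[y1y yy2] yd.
set l := (x2 - x1) + (y2 - y1) => lr.
have near x' y' : x1 <= x' <= x2 -> y1 <= y' <= y2 ->
    cmod (g (x' +i* y') - g (x +i* y) - L * ((x' +i* y') - (x +i* y))) <= e / 2 * l.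
  move=> hx' hy'.
  have hl : cmod ((x' +i* y') - (x +i* y)) <= l.
    apply: le_trans (cmod_le_ReIm _) _; rewrite /= /l.
    by apply: lerD; rewrite ler_norml; lra.
  apply: le_trans (hr _ (le_lt_trans hl lr)) _.
  by rewrite ler_pM2l.
rewrite -!segment_integralB; last 4 first.
- by apply: (eps_contW _ _ (cIm y2 _)) => //; lra.
- by apply: (eps_contW _ _ (cIm y1 _)) => //; lra.
- by apply: (eps_contW _ _ (cRe x2 _)) => //; lra.
- by apply: (eps_contW _ _ (cRe x1 _)) => //; lra.
(* Cauchy-Riemann: the real part of L (x2 - x1) is Re L (x2 - x1) and the imaginary part of L i (y2
   - y1) is Re L (y2 - y1). Hence both differences of integrals approximate Re L times the area, and
   this cancels in [I1 - I2]. *)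
have hRe : `|segment_integral (fun y => complex.Re (g (x2 +i* y)) -
      complex.Re (g (x1 +i* y))) y1 y2 - (complex.Re L * (x2 - x1)) * (y2 - y1)|
      <= e * l * (y2 - y1).
  apply: segment_integral_near; first lra.
    apply: eps_contB.
      by apply: (eps_contW _ _ (cRe x2 _)) => //; lra.
    by apply: (eps_contW _ _ (cRe x1 _)) => //; lra.
  move=> y' hy'.
  have h1 : x1 <= x2 <= x2 by lra.
  have h2 : x1 <= x1 <= x2 by lra.
  have := near _ _ h1 hy'; have := near _ _ h2 hy'.
  set r1 := (X in cmod X <= _ -> _) => hr1; set r2 := (X in cmod X <= _) => hr2.
  have -> : complex.Re (g (x2 +i* y')) - complex.Re (g (x1 +i* y')) -
      complex.Re L * (x2 - x1) = complex.Re (r2 - r1).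
    rewrite /r1 /r2; case: (g (x2 +i* y')) => ? ?; case: (g (x1 +i* y')) => ? ?.
    by case: (g (x +i* y)) => ? ?; case: (L) => ? ? /=; ring.
  apply: le_trans (cmod_Re _) _; apply: le_trans (cmodD _ _) _; rewrite cmodN.
  by lra.
have hIm : `|segment_integral (fun x => complex.Im (g (x +i* y2)) -
      complex.Im (g (x +i* y1))) x1 x2 - (complex.Re L * (y2 - y1)) * (x2 - x1)|
      <= e * l * (x2 - x1).
  apply: segment_integral_near; first lra.
    apply: eps_contB.
      by apply: (eps_contW _ _ (cIm y2 _)) => //; lra.
    by apply: (eps_contW _ _ (cIm y1 _)) => //; lra.
  move=> x' hx'.
  have h1 : y1 <= y2 <= y2 by lra.
  have h2 : y1 <= y1 <= y2 by lra.
  have := near _ _ hx' h1; have := near _ _ hx' h2.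
  set r1 := (X in cmod X <= _ -> _) => hr1; set r2 := (X in cmod X <= _) => hr2.
  have -> : complex.Im (g (x' +i* y2)) - complex.Im (g (x' +i* y1)) -
      complex.Re L * (y2 - y1) = complex.Im (r2 - r1).
    rewrite /r1 /r2; case: (g (x' +i* y2)) => ? ?; case: (g (x' +i* y1)) => ? ?.
    by case: (g (x +i* y)) => ? ?; case: (L) => ? ? /=; ring.
  apply: le_trans (cmod_Im _) _; apply: le_trans (cmodD _ _) _; rewrite cmodN.
  by lra.
move: hRe hIm; set I1 := (X in `|X - _|); set I2 := (X in _ -> `|X - _| <= _ -> _).
move=> hRe hIm.
have -> : I1 - I2 = (I1 - (complex.Re L * (x2 - x1)) * (y2 - y1)) -
   (I2 - (complex.Re L * (y2 - y1)) * (x2 - x1)) by ring.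
apply: le_trans (ler_normB _ _) _; apply: le_trans (lerD hRe hIm) _.
by rewrite -mulrDr addrC -/l expr2 mulrA.
Qed.

End ComplexDifferentiability.

Section ComplexDifferentiationRules.
Variable R : realType.
Implicit Types (f g k : R[i] -> R[i]) (z w p : R[i]) (e r : R).
Local Open Scope complex_scope.

Lemma cdiff_eq f g z : f =1 g -> cdiff f z -> cdiff g z.
Proof. by move=> /funext ->. Qed.

Lemma cdiff_affine (a b z : R[i]) : cdiff (fun w => a + b * w) z.
Proof.
exists b => e e0; exists 1 => // w _.
have -> : a + b * w - (a + b * z) - b * (w - z) = 0 by ring.
by rewrite cmod0 mulr_ge0 ?cmod_ge0// ltW.
Qed.

Lemma cdiff_cst (a z : R[i]) : cdiff (fun=> a) z.
Proof. by apply: cdiff_eq (cdiff_affine a 0 z) => w; rewrite mul0r addr0. Qed.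

Lemma cdiffD f g z : cdiff f z -> cdiff g z -> cdiff (fun w => f w + g w) z.
Proof.
move=> [L1 h1] [L2 h2]; exists (L1 + L2) => e e0.
have e20 : 0 < e / 2 by lra.
have [r1 r10 {}h1] := h1 _ e20; have [r2 r20 {}h2] := h2 _ e20.
exists (Num.min r1 r2); first by rewrite lt_min r10.
move=> w; rewrite lt_min => /andP[/h1 k1 /h2 k2].
have -> : f w + g w - (f z + g z) - (L1 + L2) * (w - z) =
  (f w - f z - L1 * (w - z)) + (g w - g z - L2 * (w - z)) by ring.
apply: le_trans (cmodD _ _) _.
by rewrite [e]splitr mulrDl lerD.
Qed.

Lemma cdiffM f g z : cdiff f z -> cdiff g z -> cdiff (fun w => f w * g w) z.
Proof.
move=> df dg; have [M1 M10 [s1 s10 k1]] := cdiff_lipschitz df.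
have [M2 M20 [s2 s20 k2]] := cdiff_lipschitz dg.
case: df dg => [L1 h1] [L2 h2]; exists (L1 * g z + f z * L2) => e e0.
have gz := cmod_ge0 (g z); have fz := cmod_ge0 (f z).
have e10 : 0 < e / 3 / (cmod (g z) + 1) by rewrite !divr_gt0//; lra.
have e20 : 0 < e / 3 / (cmod (f z) + 1) by rewrite !divr_gt0//; lra.
have [r1 r10 {}h1] := h1 _ e10; have [r2 r20 {}h2] := h2 _ e20.
exists (Num.min (Num.min s1 s2) (Num.min (Num.min r1 r2) (e / 3 / (M1 * M2)))).
  by rewrite !lt_min s10 s20 r10 r20 !divr_gt0// mulr_gt0.
move=> w; rewrite !lt_min => /andP[/andP[/k1 w1 /k2 w2] /andP[/andP[/h1 w3 /h2 w4] w5]].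
have -> : f w * g w - f z * g z - (L1 * g z + f z * L2) * (w - z) =
  (f w - f z - L1 * (w - z)) * g z + f z * (g w - g z - L2 * (w - z)) +
  (f w - f z) * (g w - g z) by ring.
have m0 := cmod_ge0 (w - z).
apply: le_trans (cmodD _ _) _; apply: le_trans (lerD (cmodD _ _) (lexx _)) _.
rewrite !cmodM.
have b1 : cmod (f w - f z - L1 * (w - z)) * cmod (g z) <= e / 3 * cmod (w - z).
  apply: (@le_trans _ _ (e / 3 / (cmod (g z) + 1) * cmod (w - z) * (cmod (g z) + 1))).
    by rewrite ler_pM ?cmod_ge0//; lra.
  by rewrite mulrAC divfK// gt_eqF//; lra.
have b2 : cmod (f z) * cmod (g w - g z - L2 * (w - z)) <= e / 3 * cmod (w - z).
  apply: (@le_trans _ _ ((cmod (f z) + 1) * (e / 3 / (cmod (f z) + 1) * cmod (w - z)))).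
    by rewrite ler_pM ?cmod_ge0//; lra.
  by rewrite mulrA [X in X * _]mulrC divfK// gt_eqF//; lra.
have b3 : cmod (f w - f z) * cmod (g w - g z) <= e / 3 * cmod (w - z).
  apply: (@le_trans _ _ ((M1 * M2 * cmod (w - z)) * cmod (w - z))).
    rewrite (_ : _ * _ * _ = (M1 * cmod (w - z)) * (M2 * cmod (w - z))); last by ring.
    by rewrite ler_pM ?cmod_ge0.
  by rewrite ler_wpM2r// mulrC -ler_pdivlMr ?mulr_gt0// ltW.
lra.
Qed.

Lemma cdiffX f n z : cdiff f z -> cdiff (fun w => f w ^+ n) z.
Proof.
move=> df; elim: n => [|n IH]; first exact: cdiff_cst.
by apply: cdiff_eq (cdiffM df IH) => w; rewrite exprS.
Qed.

Lemma cdiff_inv z : z != 0 -> cdiff (fun w => w^-1) z.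
Proof.
move=> z0; have m0 : 0 < cmod z by rewrite lt_neqAle eq_sym cmod_eq0 z0 cmod_ge0.
exists (- z ^- 2) => e e0.
exists (Num.min (cmod z / 2) (e * cmod z ^+ 3 / 2)).
  by rewrite lt_min !divr_gt0// mulr_gt0// exprn_gt0.
move=> w; rewrite lt_min => /andP[w1 w2].
have mw : cmod z / 2 <= cmod w.
  by have := cmod_leB z w; rewrite cmodB; lra.
have w0 : w != 0 by rewrite -cmod_eq0 gt_eqF//; lra.
have -> : w^-1 - z^-1 - - z ^- 2 * (w - z) = (w - z) * ((w - z) / (z ^+ 2 * w)).
  by field; rewrite z0 w0.
rewrite cmodM mulrC ler_wpM2r ?cmod_ge0// cmodM cmodV cmodM cmodX.
have mw0 : 0 < cmod w by lra.
rewrite ler_pdivrMr; last by rewrite mulr_gt0// exprn_gt0.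
apply: le_trans (ltW w2) _; rewrite (_ : _ / 2 = e * (cmod z ^+ 2 * (cmod z / 2))); last by field.
by rewrite !ler_pM2l// exprn_gt0.
Qed.

Lemma cdiffV f z : f z != 0 -> cdiff f z -> cdiff (fun w => (f w)^-1) z.
Proof. by move=> fz df; exact: cdiff_comp df (cdiff_inv fz). Qed.

End ComplexDifferentiationRules.

(** * The maximum modulus principle *)

Section ComplexExponential.
Variable R : realType.
Implicit Types (z w p : R[i]) (e r x y : R).
Local Open Scope complex_scope.

Lemma is_derive_eps (f : R -> R) (x L e : R) : is_derive x 1 f L -> 0 < e ->
  exists2 r : R, 0 < r & forall h : R, `|h| < r -> `|f (x + h) - f x - L * h| <= e * `|h|.
Proof.
move=> [df dL] e0; move: (df) => /cvg_ex[/= l fl].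
have lL : l = L by rewrite -dL; apply/esym/cvg_lim.
rewrite lL in fl; move/cvgrPdist_lt: fl => /(_ e e0).
rewrite near_withinE => /nbhs_ballP[r /= r0 hr]; exists r => // h hh.
have [->|h0] := eqVneq h 0; first by rewrite addr0 subrr mulr0 subr0 normr0 mulr0.
have := hr h; rewrite -ball_normE/= sub0r normrN => /(_ hh h0).
rewrite /= /GRing.scale/= mulr1 (addrC h) distrC => le.
have -> : f (x + h) - f x - L * h = (h^-1 * (f (x + h) - f x) - L) * h.
  by rewrite mulrBl mulrAC mulVf// mul1r.
by rewrite normrM ler_wpM2r// ltW.
Qed.

Definition cexp z : R[i] :=
  (expR (complex.Re z) * cos (complex.Im z)) +i*
  (expR (complex.Re z) * sin (complex.Im z)).

Lemma cexpD z w : cexp (z + w) = cexp z * cexp w.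
Proof.
case: z w => [a b] [c d]; rewrite /cexp/= expRD cosD sinD.
by apply: complex_eqP => /=; ring.
Qed.

Lemma cmod_cexp z : cmod (cexp z) = expR (complex.Re z).
Proof.
rewrite cmodE/= !exprMn -mulrDr cos2Dsin2 mulr1 sqrtr_sqr ger0_norm// expR_ge0.
Qed.

Lemma cexp_period x : cexp (x +i* (2 * pi)) = cexp (x +i* 0).
Proof. by rewrite /cexp/= cos0 sin0 mulr2n mulrDl mul1r -mulr2n cos2pi sin2pi. Qed.

Lemma cexp_real x : cexp (x +i* 0) = (expR x)%:C.
Proof. by rewrite /cexp/= cos0 sin0 mulr1 mulr0. Qed.

(** As exp (z + h) = exp z exp h, it suffices to differentiate at 0, where the error is assembled
    from the real derivatives of exp, sin and cos. *)
Lemma cdiff_cexp z : cdiff cexp z.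
Proof.
exists (cexp z) => e e0.
pose E := expR (complex.Re z); have E0 : 0 < E by exact: expR_gt0.
(* The real and imaginary errors come out as 3 e1 m and 4 e1 m, hence the 8; e1 <= 1 yields |1 + x|
   <= 2. *)
have [e1 [e10 e11 e1e]] : exists e1, [/\ 0 < e1, e1 <= 1 & e1 <= e / E / 8].
  exists (Num.min (e / E / 8) 1).
  by rewrite lt_min ltr01 andbT !divr_gt0// !ge_min !lexx orbT.
have [r1 r10 h1] := is_derive_eps (is_derive_expR (0 : R)) e10.
have [r2 r20 h2] := is_derive_eps (is_derive_sin (0 : R)) e10.
have [r3 r30 h3] := is_derive_eps (is_derive_cos (0 : R)) e10.
exists (Num.min e1 (Num.min r1 (Num.min r2 r3))).
  by rewrite !lt_min e10 r10 r20.
move=> w; rewrite !lt_min => /and4P[]; set h := w - z => he hr1 hr2 hr3.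
have -> : cexp w - cexp z - cexp z * h = cexp z * (cexp h - 1 - h).
  have -> : cexp w = cexp z * cexp h by rewrite -cexpD addrC subrK.
  by ring.
rewrite cmodM cmod_cexp -/E; clearbody h.
suff : cmod (cexp h - 1 - h) <= e / E * cmod h.
  move=> k; apply: le_trans (ler_wpM2l (ltW E0) k) _.
  by rewrite mulrA mulrCA divff ?mulr1// gt_eqF.
apply: le_trans (cmod_le_ReIm _) _.
have := cmod_Re h; have := cmod_Im h.
rewrite !ReB !ImB /cexp /= subr0.
move: he hr1 hr2 hr3; set x := complex.Re h; set y := complex.Im h.
set m := cmod h => me m1 m2 m3 ym xm.
have /h1 := le_lt_trans xm m1; rewrite !add0r expR0 mul1r => hx.
have /h2 := le_lt_trans ym m2; rewrite !add0r sin0 cos0 subr0 mul1r => hs.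
have /h3 := le_lt_trans ym m3; rewrite !add0r cos0 sin0 oppr0 mul0r subr0 => hc.
have hx' : `|expR x - 1 - x| <= e1 * m by apply: le_trans hx _; rewrite ler_pM2l.
have hs' : `|sin y - y| <= e1 * m by apply: le_trans hs _; rewrite ler_pM2l.
have hc' : `|cos y - 1| <= e1 * m by apply: le_trans hc _; rewrite ler_pM2l.
have m0 : 0 <= m by exact: cmod_ge0.
have mm : e1 * m <= m by rewrite ler_piMl.
have mb (u v A B : R) : `|u| <= A -> `|v| <= B -> `|u * v| <= A * B.
  by move=> uA vB; rewrite normrM ler_pM.
have x2 : `|1 + x| <= 2.
  by apply: le_trans (ler_normD _ _) _; rewrite normr1; lra.
have sin1 : `|sin y| <= 1 by rewrite ler_norml sin_geN1 sin_le1.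
have cos1 : `|cos y| <= 1 by rewrite ler_norml cos_geN1 cos_le1.
have hR : `|expR x * cos y - 1 - x| <= 3 * e1 * m.
  have -> : expR x * cos y - 1 - x = (expR x - 1 - x) * cos y + (1 + x) * (cos y - 1).
    by ring.
  apply: le_trans (ler_normD _ _) _.
  by have := mb _ _ _ _ hx' cos1; have := mb _ _ _ _ x2 hc'; lra.
have hI : `|expR x * sin y - y| <= 4 * e1 * m.
  have -> : expR x * sin y - y =
      (expR x - 1 - x) * sin y + (1 + x) * (sin y - y) + x * y by ring.
  apply: le_trans (ler_normD _ _) _.
  apply: le_trans (lerD (ler_normD _ _) (lexx _)) _.
  have xe : `|x| <= e1 by lra.
  have := mb _ _ _ _ xe ym.
  by have := mb _ _ _ _ hx' sin1; have := mb _ _ _ _ x2 hs'; lra.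
have : 8 * e1 * m <= e / E * m by rewrite ler_wpM2r//; lra.
have : 0 <= e1 * m by rewrite mulr_ge0// ltW.
move: hR hI; lra.
Qed.

End ComplexExponential.

Section MaximumModulus.
Variable R : realType.
Implicit Types (k : R[i] -> R[i]) (z w p : R[i]) (e r x y : R).
Local Open Scope complex_scope.

(** The substitution z -> p + exp z turns circles about p into vertical segments. On the rectangle
    [x, s] x [0, T] the horizontal sides cancel by periodicity, so by [goursat] the integral is the
    same for all x <= s; as x decreases the circle shrinks to p. *)
Lemma mean_value_circle k p r s T : 0 <= T ->
  (forall x, cexp (x +i* T) = cexp (x +i* 0)) ->
  (forall w, cmod (w - p) < r -> cdiff k w) ->
  expR s < r ->
  eps_cont 0 T (fun t => complex.Re (k (p + cexp (s +i* t)))) /\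
  segment_integral (fun t => complex.Re (k (p + cexp (s +i* t)))) 0 T =
  complex.Re (k p) * T.
Proof.
move=> T0 perT dk sr; pose g z := k (p + cexp z).
have dg x y : x <= s -> cdiff g (x +i* y).
  move=> xs; apply: (@cdiff_comp R k (fun z => p + cexp z)).
    have := cdiff_comp (cdiff_cexp (x +i* y)) (cdiff_affine p 1 (cexp (x +i* y))).
    move=> [L hL]; exists L => e /hL[r' r0 hr].
    by exists r' => // w /hr; rewrite /= !mul1r.
  apply: dk; rewrite addrC addKr cmod_cexp/=; apply: le_lt_trans sr.
  by rewrite ler_expR.
have cg x : x <= s -> eps_cont 0 T (fun t => complex.Re (g (x +i* t))).
  move=> xs y hy e e0; have [r' r0 hr] := cdiff_cont (dg x y xs) e0.
  exists r' => // y' _ yy; rewrite -ReB; apply: le_lt_trans (cmod_Re _) _.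
  by apply: hr; rewrite cmodE/= subrr expr0n add0r sqrtr_sqr.
split; first exact: cg.
have indep x : x <= s ->
    segment_integral (fun t => complex.Re (g (s +i* t))) 0 T =
    segment_integral (fun t => complex.Re (g (x +i* t))) 0 T.
  move=> xs; have := @goursat R g x s 0 T xs T0.
  have -> : (fun x => complex.Im (g (x +i* T))) =
            (fun x => complex.Im (g (x +i* 0))).
    by apply/funext => t; rewrite /g perT.
  rewrite [X in _ - X = 0]subrr [X in X = 0]subr0 => h.
  apply/eqP; rewrite -subr_eq0; apply/eqP/h.
  by move=> x' y' /andP[_ x's] _; exact: dg.
apply/eqP; rewrite -subr_eq0; apply: contrapT => /negP.
rewrite -normr_gt0; set D := `|_| => D0.
have dp : cdiff k p by apply: dk; rewrite subrr cmod0 (lt_trans _ sr)// expR_gt0.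
have e0 : 0 < D / (T + 1) by rewrite divr_gt0//; lra.
have [r' r0 hr] := cdiff_cont dp e0.
(* On the circle of radius exp x < r' the real part of k is within D / (T + 1) of its value at p;
   over the length T this amounts to less than D. *)
pose x := Num.min s (ln (r' / 2)).
have xs : x <= s by rewrite ge_min lexx.
have xr : expR x < r'.
  apply: (@le_lt_trans _ _ (r' / 2)); last lra.
  rewrite -[leRHS]lnK ?posrE ?divr_gt0// ler_expR.
  by rewrite ge_min lexx orbT.
have hx t : 0 <= t <= T ->
    `|complex.Re (g (x +i* t)) - complex.Re (k p)| <= D / (T + 1).
  move=> _; rewrite -ReB; apply: le_trans (cmod_Re _) (ltW _).
  by apply: hr; rewrite addrC addKr cmod_cexp.
have : D <= D / (T + 1) * T.
  have DE : D = `|segment_integral (fun t => complex.Re (g (x +i* t))) 0 T -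
      complex.Re (k p) * T| by rewrite /D -(indep _ xs).
  have := segment_integral_near T0 (cg x xs) hx.
  by rewrite [T - 0]subr0 -DE.
rewrite leNgt => /negP; apply.
rewrite mulrAC ltr_pdivrMr; last by lra.
by rewrite ltr_pM2l//; lra.
Qed.

(** With c the conjugate of k p, Re (c k) is at most |k p|^2 in the disc and has this value as its
    mean over the circle of radius t, so it attains it at the angle 0. Going in one direction is
    enough for [max_modulus]. *)
Lemma max_modulus_ray k p r : (forall w, cmod (w - p) < r -> cdiff k w) ->
  (forall w, cmod (w - p) < r -> cmod (k w) <= cmod (k p)) ->
  forall t, 0 < t < r -> cmod (k (p + t%:C)) = cmod (k p).
Proof.
move=> dk kp t /andP[t0 tr].
have [T T0 perT] : exists2 T : R, 0 < T & forall x, cexp (x +i* T) = cexp (x +i* 0).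
  by exists (2 * pi); [rewrite mulr_gt0// pi_gt0|exact: cexp_period].
have ptr : cmod (p + t%:C - p) < r.
  by rewrite addrC addKr cmod_real ger0_norm// ltW.
apply/eqP; rewrite eq_le (kp _ ptr)/=.
pose c := (k p)^*.
have dck w : cmod (w - p) < r -> cdiff (fun w => c * k w) w.
  by move=> /dk; apply: cdiffM; exact: cdiff_cst.
have cc : cmod c = cmod (k p) by rewrite /c !cmodE; case: (k p) => a b /=; rewrite sqrrN.
have ckp : complex.Re (c * k p) = cmod (k p) ^+ 2.
  by rewrite cmod_sqr /c; case: (k p) => a b /=; ring.
have sr : expR (ln t) < r by rewrite lnK ?posrE.
have [cont mean] := mean_value_circle (ltW T0) perT dck sr.
have le0 w : cmod (w - p) < r -> complex.Re (c * k w) <= cmod (k p) ^+ 2.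
  move=> wr; apply: le_trans (ler_norm _) _; apply: le_trans (cmod_Re _) _.
  rewrite cmodM cc expr2; apply: ler_wpM2l; first exact: cmod_ge0.
  exact: kp.
pose f t' := cmod (k p) ^+ 2 - complex.Re (c * k (p + cexp (ln t +i* t'))).
have : f 0 = 0.
  apply: (@segment_integral_le0_eq R 0 T) => //.
  - by apply: eps_contB => //; exact: eps_cont_cst.
  - move=> x _; rewrite subr_ge0; apply: le0.
    by rewrite addrC addKr cmod_cexp.
  - rewrite segment_integralB//; last exact: eps_cont_cst.
    by rewrite mean ckp segment_integral_cst ?(ltW T0)// subr0 subrr.
rewrite /f cexp_real lnK ?posrE// => /eqP; rewrite subr_eq0 => /eqP h.
have : cmod (k p) ^+ 2 <= cmod (k p) * cmod (k (p + t%:C)).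
  rewrite h -cc -cmodM; apply: le_trans (ler_norm _) _; exact: cmod_Re.
have [->|k0] := eqVneq (cmod (k p)) 0; first by rewrite cmod_ge0.
by rewrite expr2 ler_pM2l// lt_neqAle eq_sym k0 cmod_ge0.
Qed.

Lemma cdiff_within_continuous (K : set (R * R)) k :
  (forall x y, K (x, y) -> cdiff k (x +i* y)) ->
  {within K, continuous (fun q : R * R => cmod (k (q.1 +i* q.2)))}.
Proof.
move=> dk; apply/subspace_continuousP => -[x y] /= Kxy.
apply/cvgrPdist_lt => e e0; have [r r0 hr] := cdiff_cont (dk _ _ Kxy) e0.
rewrite near_withinE; apply/nbhs_ballP; exists (r / 2); first by rewrite /= divr_gt0.
move=> [u v] [/= bu bv] _.
have ur : `|x - u| < r / 2 by move: bu; rewrite -ball_normE.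
have vr : `|y - v| < r / 2 by move: bv; rewrite -ball_normE.
have /hr h : cmod ((u +i* v) - (x +i* y)) < r.
  apply: le_lt_trans (cmod_le_ReIm _) _ => /=.
  by rewrite distrC [X in _ + X]distrC; lra.
apply: le_lt_trans h; rewrite ler_norml.
have := cmod_leB (k (u +i* v)) (k (x +i* y)).
have := cmod_leB (k (x +i* y)) (k (u +i* v)).
by rewrite (cmodB (k (x +i* y))); lra.
Qed.

(** Among the points where |k| is maximal take one with the largest real part: around an interior
    one, [max_modulus_ray] would produce another further to the right. This stands in for a
    connectedness argument. *)
Lemma max_modulus (K : set (R * R)) k B : compact K ->
  (forall x y, K (x, y) -> cdiff k (x +i* y)) ->
  (forall x y, K (x, y) ->
    (exists2 r : R, 0 < r & forall u v, cmod ((u +i* v) - (x +i* y)) < r -> K (u, v))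
    \/ cmod (k (x +i* y)) <= B) ->
  forall x y, K (x, y) -> cmod (k (x +i* y)) <= B.
Proof.
move=> cK dk bd x0 y0 Kxy0; rewrite leNgt; apply/negP => ltB.
pose F (q : R * R) := cmod (k (q.1 +i* q.2)).
(* The image of K under (|k|, Re) is compact; maximizing its first coordinate, then its second,
   selects a rightmost maximum. *)
have cF : {within K, continuous (fun q => (F q, q.1))}.
  have /subspace_continuousP cF := cdiff_within_continuous dk.
  apply/subspace_continuousP => q Kq.
  apply: (@cvg_pair _ _ _ _ (nbhs (F q)) (nbhs q.1)); first exact: cF.
  by apply: cvg_within_filter; case: q {Kq} => x y; exact: cvg_fst.
have c1 : continuous (fst : R * R -> R) by move=> [x y]; exact: cvg_fst.
have c2 : continuous (snd : R * R -> R) by move=> [x y]; exact: cvg_snd.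
have cS := continuous_compact cF cK.
set S := [set _ | _ in _] in cS.
have S0 : S !=set0 by exists (F (x0, y0), x0), (x0, y0).
have [q1 /set_mem Sq1 max1] := compact_EVT_max S0 cS (continuous_subspaceT c1).
pose M := q1.1.
pose S1 := S `&` [set q | q.1 = M].
have cS1 : compact S1.
  apply: (subclosed_compact _ cS); last by move=> q [].
  apply: closedI; first by apply: compact_closed cS; exact: norm_hausdorff.
  by apply: (proj1 (continuous_closedP fst) c1 [set M]); exact: closed_eq.
have S10 : S1 !=set0 by exists q1.
have [q2 /set_mem [[[x y] Kxy <-] /= FM] max2] := compact_EVT_max S10 cS1 (continuous_subspaceT c2).
have Fmax u v : K (u, v) -> F (u, v) <= M.
  by move=> Kuv; have := max1 (F (u, v), u); apply; apply/mem_set; exists (u, v).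
have MB : B < M by apply: lt_le_trans ltB (Fmax _ _ Kxy0).
have [[r r0 hr]|] := bd _ _ Kxy; last by rewrite leNgt -/(F (x, y)) FM MB.
have KI w : cmod (w - (x +i* y)) < r -> K (complex.Re w, complex.Im w).
  by case: w => u v; exact: hr.
have /= h := @max_modulus_ray k (x +i* y) r _ _ (r / 2) _.
have : F (x + r / 2, y) = M.
  rewrite -FM /F /= -[RHS]h; last 3 first.
  - by case=> u v /hr /dk.
  - by case=> u v /hr /Fmax; rewrite -FM.
  - by lra.
  by congr (cmod (k _)); apply: complex_eqP => /=; rewrite ?addr0.
move=> FM'; have := max2 (M, x + r / 2); rewrite leNgt => /(_ _)/negP; apply.
  apply/mem_set; split => //; exists (x + r / 2, y); rewrite ?FM'//.
  apply: hr; rewrite cmodE/= subrr expr0n addr0 sqrtr_sqr addrC addKr.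
  by rewrite ger0_norm; lra.
by rewrite /=; lra.
Qed.

End MaximumModulus.

(** * A two-constants estimate on half-discs *)

Section HalfDisc.
Variable R : realType.
Implicit Types (h : R[i] -> R[i]) (z w : R[i]) (c r d e M sg : R).
Local Open Scope complex_scope.

(** [sg] is meant to be 1 or -1, for the upper or the lower half. *)
Let half_disc c r sg : set (R * R) :=
  [set q | (q.1 - c) ^+ 2 + q.2 ^+ 2 <= r ^+ 2 /\ 0 <= sg * q.2].

Let compact_half_disc c r sg : 0 < r -> compact (half_disc c r sg).
Proof.
move=> r0.
have c1 : continuous (fst : R * R -> R) by move=> [x y]; exact: cvg_fst.
have c2 : continuous (snd : R * R -> R) by move=> [x y]; exact: cvg_snd.
apply: (@subclosed_compact _ _ (`[c - r, c + r] `*` `[- r, r])); last 2 first.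
- by apply: compact_setX; exact: segment_compact.
- move=> [x y] [/= h _]; rewrite !in_itv/=.
  have hx : (x - c) ^+ 2 <= r ^+ 2 by apply: le_trans h; rewrite lerDl sqr_ge0.
  have hy : y ^+ 2 <= r ^+ 2 by apply: le_trans h; rewrite lerDr sqr_ge0.
  have : `|x - c| <= r by rewrite -ler_sqr ?nnegrE ?(ltW r0)// real_normK ?num_real.
  have : `|y| <= r by rewrite -ler_sqr ?nnegrE ?(ltW r0)// real_normK ?num_real.
  by rewrite !ler_norml => ? ?; split; lra.
have c3 : continuous (fun q : R * R => q.1 - c).
  move=> q; apply: cvgB; [exact: c1|exact: cvg_cst].
have c4 : continuous (fun q : R * R => (q.1 - c) * (q.1 - c) + q.2 * q.2).
  by move=> q; apply: cvgD; apply: cvgM; (exact: c3 || exact: c2).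
apply: closedI.
  exact: (proj1 (continuous_closedP _) c4 [set x | x <= r ^+ 2] (@closed_le _ _)).
apply: (proj1 (continuous_closedP (fun q : R * R => sg * q.2)) _
    [set x | 0 <= x]); last exact: closed_ge.
by move=> q; apply: cvgM; [exact: cvg_cst|exact: c2].
Qed.

Lemma half_disc_bounded h c r sg : 0 < r ->
  (forall w, cmod (w - c%:C) <= r -> 0 <= sg * complex.Im w -> cdiff h w) ->
  exists M, forall w, cmod (w - c%:C) <= r -> 0 <= sg * complex.Im w ->
    cmod (h w) <= M.
Proof.
move=> r0 dh.
have inP w : half_disc c r sg (complex.Re w, complex.Im w) <->
    cmod (w - c%:C) <= r /\ 0 <= sg * complex.Im w.
  rewrite /half_disc/=.
  have -> : (complex.Re w - c) ^+ 2 + complex.Im w ^+ 2 = cmod (w - c%:C) ^+ 2.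
    by rewrite cmod_sqr ReB ImB /= subr0.
  by rewrite ler_sqr ?nnegrE ?cmod_ge0// ltW.
have K0 : half_disc c r sg !=set0.
  exists (c, 0); rewrite /half_disc/= subrr expr0n addr0 mulr0.
  by split => //; exact: sqr_ge0.
have cK := @compact_half_disc c r sg r0.
have cF : {within half_disc c r sg, continuous (fun q => cmod (h (q.1 +i* q.2)))}.
  by apply: cdiff_within_continuous => x y /(inP (x +i* y))[]; exact: dh.
have [q _ hq] := compact_EVT_max K0 cK cF.
exists (cmod (h (q.1 +i* q.2))) => w wr sw.
have := hq (complex.Re w, complex.Im w).
by case: w wr sw => a b wr sw; apply; apply/mem_set/inP.
Qed.

(* The factor [(w - c + i sg d)^-n] is dominated on the arc by its value at
   [z], so it kills the contribution of the arc as [n] grows. *)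
Lemma half_disc_bound h c r sg d n M e z : 0 < r -> sg ^+ 2 = 1 -> 0 < d ->
  (forall w, cmod (w - c%:C) <= r -> 0 <= sg * complex.Im w ->
     cdiff h w) ->
  (forall w, cmod (w - c%:C) <= r -> complex.Im w = 0 -> cmod (h w) <= e) ->
  (forall w, cmod (w - c%:C) = r -> 0 <= sg * complex.Im w -> cmod (h w) <= M) ->
  cmod (z - c%:C) <= r -> 0 <= sg * complex.Im z ->
  cmod (h z) <=
    Num.max (e * ((cmod (z - c%:C) + d) / d) ^+ n)
            (M * ((cmod (z - c%:C) + d) / r) ^+ n).
Proof.
move=> r0 sg1 d0 dh he hM zr sz.
pose a w : R[i] := w - c%:C + 0 +i* (sg * d).
pose k w := h w * ((a w)^-1) ^+ n.
have aRe w : complex.Re (a w) = complex.Re w - c by case: w => ? ?; rewrite /a/= addr0.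
have aIm w : complex.Im (a w) = complex.Im w + sg * d by case: w => ? ?; rewrite /a/= subr0.
have a2 w : cmod (a w) ^+ 2 = cmod (w - c%:C) ^+ 2 + 2 * (sg * complex.Im w) * d + d ^+ 2.
  rewrite !cmod_sqr aRe aIm !ReB !ImB /= subr0.
  by rewrite [(_ + sg * d) ^+ 2]sqrrD exprMn sg1; ring.
have ad w : 0 <= sg * complex.Im w -> d <= cmod (a w).
  move=> sw; rewrite -ler_sqr ?nnegrE ?cmod_ge0 ?(ltW d0)// a2.
  rewrite lerDr addr_ge0 ?sqr_ge0// mulr_ge0 ?(ltW d0)//; lra.
have ar w : 0 <= sg * complex.Im w -> cmod (w - c%:C) = r -> r <= cmod (a w).
  move=> sw wr; rewrite -ler_sqr ?nnegrE ?cmod_ge0 ?(ltW r0)// a2 wr -addrA lerDl.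
  by rewrite addr_ge0 ?sqr_ge0// mulr_ge0 ?(ltW d0)//; lra.
have kE w : cmod (k w) = cmod (h w) / cmod (a w) ^+ n.
  by rewrite /k cmodM cmodX cmodV exprVn.
have e0 : 0 <= e.
  apply: le_trans (cmod_ge0 (h c%:C)) _; apply: he => //.
  by rewrite subrr cmod0 ltW.
have M0 : 0 <= M.
  apply: le_trans (cmod_ge0 (h (c + r)%:C)) _; apply: hM => //=.
    by rewrite rmorphD/= addrC addKr cmod_real ger0_norm// ltW.
  by rewrite mulr0.
have disc2 w : (complex.Re w - c) ^+ 2 + complex.Im w ^+ 2 = cmod (w - c%:C) ^+ 2.
  by rewrite cmod_sqr ReB ImB /= subr0.
have inP w : half_disc c r sg (complex.Re w, complex.Im w) <->
    cmod (w - c%:C) <= r /\ 0 <= sg * complex.Im w.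
  rewrite /half_disc/= disc2.
  by rewrite ler_sqr ?nnegrE ?cmod_ge0// ltW.
(* Three cases for [max_modulus]: |a| >= d on the diameter, |a| >= r on the arc, and any other point
   is the centre of a disc inside the half-disc, with the smaller of r - |w - c| and sg Im w as
   radius. *)
have key : cmod (k z) <= Num.max (e / d ^+ n) (M / r ^+ n).
  have := @max_modulus R (half_disc c r sg) k (Num.max (e / d ^+ n) (M / r ^+ n))
    (@compact_half_disc c r sg r0) _ _ (complex.Re z) (complex.Im z).
  have <- : z = complex.Re z +i* complex.Im z by case: (z).
  apply; last by apply/inP.
    move=> x y /(inP (x +i* y))[xr sy].
    apply: cdiffM; first exact: dh.
    apply/cdiffX/cdiffV.
      by rewrite -cmod_eq0 gt_eqF// (lt_le_trans d0 (ad _ sy)).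
    apply: cdiff_eq (cdiff_affine (- c%:C + 0 +i* (sg * d)) 1 _) => w.
    by rewrite mul1r /a addrC addrA.
  move=> x y /(inP (x +i* y))[xr sy].
  have [y0|y0] := eqVneq y 0.
    right; rewrite kE le_max; apply/orP; left.
    rewrite ler_pM ?cmod_ge0 ?invr_ge0 ?exprn_ge0 ?cmod_ge0//; first exact: he.
    by rewrite lef_pV2 ?posrE ?exprn_gt0 ?(lt_le_trans d0 (ad _ sy))// lerXn2r
      ?nnegrE ?cmod_ge0 ?ad// ltW.
  have [xr'|xr'] := eqVneq (cmod (x +i* y - c%:C)) r.
    right; rewrite kE le_max; apply/orP; right.
    rewrite ler_pM ?cmod_ge0 ?invr_ge0 ?exprn_ge0 ?cmod_ge0//; first exact: hM.
    by rewrite lef_pV2 ?posrE ?exprn_gt0 ?(lt_le_trans d0 (ad _ sy))// lerXn2r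
      ?nnegrE ?cmod_ge0 ?ar// ltW.
  have ltr : cmod (x +i* y - c%:C) < r by rewrite lt_neqAle xr'.
  have sy0 : 0 < sg * y.
    rewrite lt_neqAle sy andbT eq_sym mulf_neq0//.
    by apply: contra_eq_neq sg1 => ->; rewrite expr0n/= eq_sym oner_neq0.
  left; exists (Num.min (r - cmod (x +i* y - c%:C)) (sg * y)).
    by rewrite lt_min subr_gt0 ltr.
  move=> u v; rewrite lt_min => /andP[h1 h2]; apply/(inP (u +i* v)); split.
    have -> : u +i* v - c%:C = (u +i* v - x +i* y) + (x +i* y - c%:C) by ring.
    by apply: le_trans (cmodD _ _) _; lra.
  have := le_lt_trans (cmod_Im _) h2; rewrite ImB/= => h3.
  have : `|sg * (v - y)| < sg * y.
    by rewrite normrM (_ : `|sg| = 1) ?mul1r//; apply/eqP; rewrite -sqr_norm_eq1 sg1.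
  by rewrite ltr_norml mulrBr; lra.
have azd : cmod (a z) <= cmod (z - c%:C) + d.
  apply: le_trans (cmodD _ _) _; rewrite lerD2l cmodE/= expr0n add0r exprMn sg1 mul1r.
  by rewrite sqrtr_sqr ger0_norm// ltW.
have az0 : 0 < cmod (a z) by exact: lt_le_trans d0 (ad _ sz).
have -> : cmod (h z) = cmod (k z) * cmod (a z) ^+ n.
  by rewrite kE divfK// gt_eqF// exprn_gt0.
set m := cmod (z - c%:C) + d in azd *.
apply: (@le_trans _ _ (Num.max (e / d ^+ n) (M / r ^+ n) * m ^+ n)).
  apply: ler_pM => //; rewrite ?cmod_ge0 ?exprn_ge0 ?cmod_ge0//.
  by rewrite lerXn2r ?nnegrE ?cmod_ge0// (le_trans (ltW az0)).
rewrite maxr_pMl; last by rewrite exprn_ge0// (le_trans (ltW az0)).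
by rewrite !expr_div_n !(mulrAC _ _ (m ^+ n)) !mulrA.
Qed.

(** d = (r - m) / 2 makes (m + d) / r < 1. Then n is chosen to make the arc term small, and e' last,
    to outweigh the factor ((m + d) / d)^n of the diameter term. As e' is chosen before [h], a whole
    sequence of functions is handled at once. *)
Lemma half_disc_small c r sg M z e : 0 < r -> sg ^+ 2 = 1 -> 0 < e ->
  cmod (z - c%:C) < r -> 0 <= sg * complex.Im z ->
  exists2 e' : R, 0 < e' & forall h,
  (forall w, cmod (w - c%:C) <= r -> 0 <= sg * complex.Im w ->
     cdiff h w) ->
  (forall w, cmod (w - c%:C) <= r -> complex.Im w = 0 -> cmod (h w) <= e') ->
  (forall w, cmod (w - c%:C) = r -> 0 <= sg * complex.Im w -> cmod (h w) <= M) ->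
  cmod (h z) <= e.
Proof.
move=> r0 sg1 e0 zr sz; pose m := cmod (z - c%:C); pose d := (r - m) / 2.
have m0 : 0 <= m by exact: cmod_ge0.
have mr : m < r by [].
have d0 : 0 < d by rewrite /d; lra.
have q1 : `|(m + d) / r| < 1.
  by rewrite ger0_norm ?divr_ge0 ?ltr_pdivrMr// /d; lra.
have [n /(_ n (leqnn n)) hn] := geometric_lt M q1 e0.
have t0 : 0 < ((m + d) / d) ^+ n by rewrite exprn_gt0 ?divr_gt0//; lra.
exists (e / ((m + d) / d) ^+ n); first by rewrite divr_gt0.
move=> h dh he hM; have := half_disc_bound n r0 sg1 d0 dh he hM (ltW zr) sz.
move/le_trans; apply; rewrite ge_max -/m divfK ?gt_eqF// lexx/=.
by apply/ltW; apply: le_lt_trans hn; exact: ler_norm.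
Qed.

End HalfDisc.

(** * Taylor expansions of Bernstein functions *)

Lemma is_derive_ge0_le (R : realType) (f df : R -> R) (a b : R) : a <= b ->
  (forall x, a <= x <= b -> is_derive x 1 f (df x)) ->
  (forall x, a <= x <= b -> 0 <= df x) -> f a <= f b.
Proof.
rewrite le_eqVlt => /predU1P[->//|ab] df1 df0.
have cf : {within `[a, b], continuous f}.
  apply: derivable_within_continuous => x; rewrite in_itv/= => /df1 h.
  exact: ex_derive.
have [|c] := @MVT R f df a b ab _ cf.
  by move=> x; rewrite in_itv/= => /andP[ax xb]; apply: df1; rewrite !ltW.
rewrite in_itv/= => /andP[ac cb] fE; rewrite -subr_ge0 fE mulr_ge0//; last lra.
by apply: df0; rewrite !ltW.
Qed.

Section AbsolutelyMonotone.
Variables (R : realType) (b : R) (Phi : nat -> R -> R).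
Implicit Types (r q : R) (j N : nat).
Hypothesis dPhi : forall n r, 0 <= r < b -> is_derive r 1 (Phi n) (Phi n.+1 r).
Hypothesis Phi_ge0 : forall n r, 0 <= r < b -> 0 <= Phi n.+1 r.

Definition taylor_sum j N r := \sum_(n < N) Phi (j + n)%N 0 / n`!%:R * r ^+ n.
Definition taylor_rem j N r := Phi j r - taylor_sum j N r.

Lemma taylor_sum0 j r : taylor_sum j 0 r = 0.
Proof. by rewrite /taylor_sum big_ord0. Qed.

(** Termwise differentiation, with [F n] in place of the n-th power so that it can be iterated. At n
    = 0, where [n.-1] is a default, the factor n kills the term. *)
Lemma taylor_sum_shift j N (F : nat -> R) :
  \sum_(n < N.+1) Phi (j + n)%N 0 / n`!%:R * (n%:R * F n.-1) =
  \sum_(n < N) Phi (j.+1 + n)%N 0 / n`!%:R * F n.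
Proof.
rewrite big_ord_recl /= mul0r mulr0 add0r; apply: eq_bigr => n _.
rewrite /bump/= add1n addnS factS natrM invfM; field.
by rewrite -(natrD _ 1%N) !pnatr_eq0 -lt0n fact_gt0.
Qed.

Lemma taylor_sumS j N r :
  taylor_sum j.+1 N r =
  \sum_(n < N.+1) Phi (j + n)%N 0 / n`!%:R * (n%:R * r ^+ n.-1).
Proof. by rewrite (taylor_sum_shift j N (fun n => r ^+ n)). Qed.

Lemma taylor_sumSS j N r :
  taylor_sum j.+2 N r =
  \sum_(n < N.+2) Phi (j + n)%N 0 / n`!%:R * (n%:R * (n.-1%:R * r ^+ n.-2)).
Proof.
by rewrite (taylor_sum_shift j N.+1 (fun n => n%:R * r ^+ n.-1)) taylor_sumS.
Qed.

Lemma is_derive_taylor_sum j N r :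
  is_derive r 1 (taylor_sum j N.+1) (taylor_sum j.+1 N r).
Proof.
pose h (n : 'I_N.+1) := (Phi (j + n)%N 0 / n`!%:R) *: (@id R ^+ n).
have -> : taylor_sum j N.+1 = \sum_(n < N.+1) h n.
  apply/funext => x; rewrite fct_sumE; apply: eq_bigr => i _.
  by rewrite /h !fctE.
pose dh (n : 'I_N.+1) := Phi (j + n)%N 0 / n`!%:R * (n%:R * r ^+ n.-1).
have := @is_derive_sum _ _ _ _ h r 1 dh.
have -> : taylor_sum j.+1 N r = \sum_(n < N.+1) dh n.
  exact: taylor_sumS.
apply => n; apply: is_deriveZ.
by have := @is_deriveX _ _ _ n _ _ _ (is_derive_id r 1); rewrite /GRing.scale/= mulr1.
Qed.

Lemma is_derive_taylor_rem j N r : 0 <= r < b ->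
  is_derive r 1 (taylor_rem j N.+1) (taylor_rem j.+1 N r).
Proof. by move=> hr; apply: is_deriveB; [exact: dPhi|exact: is_derive_taylor_sum]. Qed.

Lemma taylor_rem_at0 j N : taylor_rem j N.+1 0 = 0.
Proof.
rewrite /taylor_rem /taylor_sum big_ord_recl big1 /= ?addn0 ?fact0 ?divr1 ?expr0
  ?mulr1 ?addr0 ?subrr// => i _.
by rewrite expr0n mulr0.
Qed.

(** [taylor_rem j N.+1] vanishes at 0 and has derivative [taylor_rem j.+1 N], so positivity is
    inherited from the higher derivatives. The condition 0 < j + N excludes just [Phi 0] itself,
    whose sign is free. *)
Lemma taylor_rem_ge0 j N r : (0 < j + N)%N -> 0 <= r < b -> 0 <= taylor_rem j N r.
Proof.
elim: N j r => [|N IH] j r.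
  rewrite addn0 /taylor_rem taylor_sum0 subr0; case: j => // j _; exact: Phi_ge0.
move=> _ /andP[r0 rb]; rewrite -(taylor_rem_at0 j N).
apply: (@is_derive_ge0_le _ _ (taylor_rem j.+1 N)) => // x /andP[x0 xr].
  by apply: is_derive_taylor_rem; rewrite x0 (le_lt_trans xr).
by apply: IH; rewrite ?x0 ?(le_lt_trans xr).
Qed.

(** Bernstein's argument: the remainder divided by r^N is nondecreasing, which for q < 1 gives
    geometric decay with no estimate of high derivatives. Differentiating the difference of both
    sides in r yields q times the same difference for j + 1 and N. *)
Lemma taylor_rem_scale j N r q : (0 < j + N)%N -> 0 <= r < b -> 0 <= q <= 1 ->
  taylor_rem j N (q * r) <= q ^+ N * taylor_rem j N r.
Proof.
elim: N j r => [|N IH] j r.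
  rewrite addn0 expr0 mul1r /taylor_rem !taylor_sum0 !subr0.
  case: j => // j _ /andP[r0 rb] /andP[q0 q1].
  apply: (@is_derive_ge0_le _ _ (Phi j.+2)); first by rewrite ler_piMl.
    move=> x /andP[x0 xr]; apply: dPhi.
    by rewrite (le_trans _ x0) ?mulr_ge0//= (le_lt_trans xr).
  move=> x /andP[x0 xr]; apply: Phi_ge0.
  by rewrite (le_trans _ x0) ?mulr_ge0//= (le_lt_trans xr).
move=> _ /andP[r0 rb] /andP[q0 q1]; rewrite -subr_ge0.
have -> : 0 = q ^+ N.+1 * taylor_rem j N.+1 0 - taylor_rem j N.+1 (q * 0).
  by rewrite mulr0 taylor_rem_at0 mulr0 subrr.
have inb x : 0 <= x <= r -> 0 <= x < b /\ 0 <= q * x < b.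
  move=> /andP[x0 xr]; have xb := le_lt_trans xr rb.
  rewrite x0 xb mulr_ge0//; split => //.
  by apply: le_lt_trans xb; rewrite ler_piMl.
apply: (@is_derive_ge0_le _ (fun x => q ^+ N.+1 * taylor_rem j N.+1 x -
    taylor_rem j N.+1 (q * x))
  (fun x => q ^+ N.+1 * taylor_rem j.+1 N x - taylor_rem j.+1 N (q * x) * q)) => //.
  move=> x /inb[xb qxb]; apply: is_deriveB.
    by have := is_deriveZ (q ^+ N.+1) (is_derive_taylor_rem j N xb).
  apply: (@is_derive1_comp _ (taylor_rem j N.+1) ( *%R q)).
    exact: is_derive_taylor_rem.
  by have := is_deriveZ q (is_derive_id x 1); rewrite /GRing.scale/= mulr1.
move=> x /inb[xb qxb].
by rewrite subr_ge0 mulrC exprS -mulrA ler_wpM2l// IH// q0.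
Qed.

End AbsolutelyMonotone.

Section PowerEstimates.
Variable R : realType.
Implicit Types (w : R[i]) (y : R).
Local Open Scope complex_scope.

(** The bound is the derivative of the monomial at the real point y times the distance; summed with
    nonnegative coefficients, such bounds give the derivative of the whole polynomial. *)
Lemma cmod_subX y w n : cmod w <= y ->
  cmod (y%:C ^+ n - w ^+ n) <= n%:R * y ^+ n.-1 * cmod (y%:C - w).
Proof.
move=> wy; have y0 : 0 <= y := le_trans (cmod_ge0 w) wy.
have m0 := cmod_ge0 (y%:C - w).
elim: n => [|n IH]; first by rewrite subrr cmod0 !mul0r.
have -> : y%:C ^+ n.+1 - w ^+ n.+1 =
    y%:C * (y%:C ^+ n - w ^+ n) + (y%:C - w) * w ^+ n by rewrite !exprS; ring.
apply: le_trans (cmodD _ _) _; rewrite !cmodM cmodX cmod_real ger0_norm//=.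
apply: (@le_trans _ _ (y * (n%:R * y ^+ n.-1 * cmod (y%:C - w)) +
    cmod (y%:C - w) * y ^+ n)).
  apply: lerD; first exact: ler_wpM2l.
  by apply: ler_wpM2l => //; rewrite lerXn2r ?nnegrE ?cmod_ge0.
case: n {IH} => [|n] /=; first by rewrite expr0; lra.
by rewrite -[n.+2%:R]natr1 [y ^+ n.+1]exprS le_eqVlt; apply/orP; left; apply/eqP; ring.
Qed.

Lemma cmod_subX2 y w n : cmod w <= y ->
  cmod (y%:C ^+ n - w ^+ n - (n%:R * y ^+ n.-1)%:C * (y%:C - w)) <=
  n%:R * (n.-1%:R * y ^+ n.-2) / 2 * cmod (y%:C - w) ^+ 2.
Proof.
move=> wy; have y0 : 0 <= y := le_trans (cmod_ge0 w) wy.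
elim: n => [|n IH].
  by rewrite subrr mul0r sub0r mul0r oppr0 cmod0 !mul0r.
have -> : y%:C ^+ n.+1 - w ^+ n.+1 - (n.+1%:R * y ^+ n.+1.-1)%:C * (y%:C - w) =
    y%:C * (y%:C ^+ n - w ^+ n - (n%:R * y ^+ n.-1)%:C * (y%:C - w)) -
    (y%:C - w) * (y%:C ^+ n - w ^+ n).
  case: n {IH} => [|n] /=; first by rewrite !expr1 !expr0 mul1r mul0r rmorph1 rmorph0; ring.
  by rewrite !rmorphM !rmorphXn/= -[n.+2%:R]natr1 rmorphD/= rmorph1 !exprS; ring.
apply: le_trans (cmodD _ _) _; rewrite cmodN !cmodM cmod_real ger0_norm//.
have m0 := cmod_ge0 (y%:C - w).
apply: (@le_trans _ _ (y * (n%:R * (n.-1%:R * y ^+ n.-2) / 2 * cmod (y%:C - w) ^+ 2) +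
  cmod (y%:C - w) * (n%:R * y ^+ n.-1 * cmod (y%:C - w)))).
  by apply: lerD; apply: ler_wpM2l => //; exact: cmod_subX.
case: n {IH} => [|[|n]] /=; rewrite ?expr0; try lra.
by rewrite -[n.+3%:R]natr1 -[n.+2%:R]natr1 [y ^+ n.+1]exprS le_eqVlt; apply/orP; left; apply/eqP; field.
Qed.

End PowerEstimates.

Section BernsteinTaylor.
Variables (R : realType) (v : R[i] -> R[i]).
Hypothesis hv : BF v.
Implicit Types (z w : R[i]) (x y e : R).
Local Open Scope complex_scope.
Let f : R -> R := real_trace v.

Lemma BF_cdiff z : 0 < complex.Re z -> cdiff v z.
Proof. by case: hv => -[dv _] _ _ _ z0; apply/derivable_cdiff/dv. Qed.

Lemma BF_real x : 0 < x -> v x%:C = (f x)%:C.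
Proof.
case: hv => _ im _ _ x0; rewrite /f /real_trace; have := im x x0.
by case: (v x%:C) => a b /= ->.
Qed.

Lemma BF_is_derive n x : 0 < x -> is_derive x 1 (f^`(n)%classic) (f^`(n.+1)%classic x).
Proof.
case: hv => _ _ [_ df _] _ x0; rewrite derive1nS derive1E.
by apply: derivableP; exact: df.
Qed.

Lemma BF_sign n x : 0 < x -> 0 <= (- 1) ^+ n.+2 * f^`(n.+1)%classic x.
Proof. by case: hv => _ _ [_ _ sf] _ x0; exact: sf. Qed.

Lemma BF_ge0 x : 0 < x -> 0 <= f x.
Proof. by case: hv => _ _ [f0 _ _] _; exact: f0. Qed.

Variable x0 : R.
Hypothesis x0_gt0 : 0 < x0.
(** The n-th derivative of r -> - f (x0 - r), nonnegative from n = 1 on. *)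
Let Phi n (r : R) : R := (- 1) ^+ n.+1 * f^`(n)%classic (x0 - r).

Let dPhi n (r : R) : 0 <= r < x0 -> is_derive r 1 (Phi n) (Phi n.+1 r).
Proof.
move=> /andP[r0 rx].
have -> : Phi n.+1 r = (- 1) ^+ n.+1 * (f^`(n.+1)%classic (x0 - r) * - 1).
  by rewrite /Phi (exprS _ n.+1); ring.
have d1 : is_derive r 1 (fun r => x0 - r) (- 1).
  have -> : (- 1 : R) = 0 - 1 by rewrite sub0r.
  exact: is_deriveB.
have xr : 0 < x0 - r by lra.
have h := @is_derive1_comp _ _ (fun r => x0 - r) r _ _ (BF_is_derive n xr) d1.
by have := is_deriveZ ((- 1) ^+ n.+1) h.
Qed.

Let Phi_ge0 n (r : R) : 0 <= r < x0 -> 0 <= Phi n.+1 r.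
Proof. by move=> /andP[r0 rx]; apply: BF_sign; lra. Qed.

Let T N w : R[i] := \sum_(n < N) (Phi n 0 / n`!%:R)%:C * w ^+ n.

Let T_real N (r : R) : T N r%:C = (taylor_sum Phi 0 N r)%:C.
Proof.
rewrite /T /taylor_sum rmorph_sum/=; apply: eq_bigr => n _.
by rewrite [RHS]rmorphM/= rmorphXn.
Qed.

Let coef_ge0 n : 0 <= Phi n.+1 0 / n.+1`!%:R.
Proof. by rewrite divr_ge0// Phi_ge0// lexx. Qed.

Let T_cdiff N z : cdiff (fun z => T N (x0%:C - z)) z.
Proof.
elim: N => [|N IH].
  by apply: cdiff_eq (cdiff_cst 0 z) => w; rewrite /T big_ord0.
apply: (@cdiff_eq _ (fun z => T N (x0%:C - z) + (Phi N 0 / N`!%:R)%:C * (x0%:C - z) ^+ N)).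
  by move=> w; rewrite /T big_ord_recr.
apply: cdiffD => //; apply: cdiffM; first exact: cdiff_cst.
by apply: cdiffX; apply: cdiff_eq (cdiff_affine x0%:C (- 1) z) => w; rewrite mulN1r.
Qed.

(** Nonnegative coefficients make the real point |w| the worst case, and there truncation drops a
    nonnegative remainder. *)
Let T_bound N w : cmod w < x0 ->
  cmod (T N.+1 w - (Phi 0 0)%:C) <= Phi 0 (cmod w) - Phi 0 0.
Proof.
move=> wx; have r0 : 0 <= cmod w < x0 by rewrite cmod_ge0.
rewrite /T big_ord_recl fact0 divr1 expr0 mulr1 addrC addKr.
have := @taylor_rem_ge0 R x0 Phi dPhi Phi_ge0 0 N.+1 (cmod w) isT r0.
rewrite /taylor_rem /taylor_sum big_ord_recl /= fact0 divr1 expr0 mulr1 addn0.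
rewrite subr_ge0 => h; rewrite lerBrDl; apply: le_trans h.
rewrite lerD2l; apply: le_trans (cmod_sum _) _.
apply: ler_sum => n _; rewrite cmodM cmodX cmod_real ger0_norm//.
Qed.

(** [half_disc_small] applied to - v - T. On the diameter this is a Taylor remainder of [Phi 0],
    small by [taylor_rem_scale]; on the arc v is bounded by compactness and T by [T_bound],
    uniformly in N. *)
Lemma BF_taylor z e : cmod (z - (x0 / 2)%:C) < x0 / 2 -> 0 < e ->
  exists N0, forall N, (N0 <= N)%N -> cmod (- v z - T N.+1 (x0%:C - z)) <= e.
Proof.
move=> zc e0; pose c := x0 / 2; pose m := cmod (z - c%:C).
have m0 : 0 <= m by exact: cmod_ge0.
have mc : m < c by [].
pose r := (m + c) / 2; have mr : m < r by rewrite /r; lra.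
have rc : r < c by rewrite /r; lra.
have r0 : 0 < r by lra.
have c2 : c + c = x0 by rewrite /c; lra.
pose sg : R := if 0 <= complex.Im z then 1 else - 1.
have sg1 : sg ^+ 2 = 1 by rewrite /sg; case: ifP; rewrite ?sqrrN expr1n.
have sz : 0 <= sg * complex.Im z.
  by rewrite /sg; case: ifPn => [|]; rewrite ?mul1r// mulN1r -ltNge oppr_ge0 => /ltW.
have inH w : cmod (w - c%:C) <= r -> 0 < complex.Re w.
  move=> wr; have := le_trans (cmod_Re _) wr; rewrite ReB/= ler_norml; lra.
have [M hM] := @half_disc_bounded R v c r sg r0 (fun w h _ => BF_cdiff (inH w h)).
(* |x0 - w| <= s on the disc of radius r about c; with s < r1 < x0, the ratio of the geometric decay
   is s / r1. *)
pose s := c + r; have sx : s < x0 by rewrite /s; lra.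
have s0 : 0 < s by rewrite /s; lra.
have Ps0 : 0 <= s < x0 by rewrite sx ltW.
have [e' e'0 he'] := @half_disc_small R c r sg
  (M + (`|Phi 0 0| + (Phi 0 s - Phi 0 0))) z e r0 sg1 e0 mr sz.
pose r1 := (s + x0) / 2; have Pr1 : 0 <= r1 < x0 by rewrite /r1; lra.
have sr1 : s < r1 by rewrite /r1; lra.
have r10 : 0 < r1 by lra.
have q1 : `|s / r1| < 1 by rewrite ger0_norm ?divr_ge0 ?ltr_pdivrMr ?mul1r//; lra.
have [N0 hN0] := geometric_lt (Phi 0 r1 - Phi 0 0) q1 e'0.
exists N0 => N N0N; apply: (he' (fun z => - v z - T N.+1 (x0%:C - z))).
- move=> w wr _; apply: cdiff_eq (cdiffD (cdiffM (cdiff_cst (- 1) w) (BF_cdiff (inH w wr)))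
    (cdiffM (cdiff_cst (- 1) w) (T_cdiff N.+1 w))) => u.
  by rewrite !mulN1r.
- move=> w wr w0; have wE : w = (complex.Re w)%:C by case: w w0 {wr} => a b /= ->.
  have wx := inH w wr; rewrite wE BF_real// -rmorphB/= T_real -rmorphN/= -rmorphB/= cmod_real.
  have := le_trans (cmod_Re _) wr; rewrite ReB/= ler_norml => /andP[w1 w2].
  set u := complex.Re w in wx w1 w2 *.
  have -> : - f u - taylor_sum Phi 0 N.+1 (x0 - u) = taylor_rem Phi 0 N.+1 (x0 - u).
    by rewrite /taylor_rem /Phi expr1 mulN1r subKr.
  have Pu : 0 <= x0 - u < x0 by rewrite /s in sx *; lra.
  have us : x0 - u <= s by rewrite /s; lra.
  rewrite ger0_norm; last exact: (taylor_rem_ge0 dPhi Phi_ge0).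
  pose q := (x0 - u) / r1.
  have q01 : 0 <= q <= 1 by rewrite divr_ge0 ?ler_pdivrMr//=; lra.
  have -> : x0 - u = q * r1 by rewrite divfK// gt_eqF.
  apply: le_trans (taylor_rem_scale dPhi Phi_ge0 _ Pr1 q01) _ => //.
  apply: (@le_trans _ _ ((s / r1) ^+ N.+1 * (Phi 0 r1 - Phi 0 0))).
    apply: ler_pM; rewrite ?exprn_ge0//; first by case/andP: q01.
    + exact: (taylor_rem_ge0 dPhi Phi_ge0).
    + rewrite lerXn2r ?nnegrE//; first by case/andP: q01.
        by rewrite divr_ge0// ltW.
      by rewrite ler_pM2r ?invr_gt0.
    + rewrite /taylor_rem lerD2l lerN2 /taylor_sum big_ord_recl fact0 divr1 expr0 mulr1.
      rewrite lerDl sumr_ge0// => n _; rewrite mulr_ge0 ?exprn_ge0//; last by case/andP: Pr1.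
      by rewrite /bump; exact: coef_ge0.
  rewrite mulrC; apply/ltW; apply: le_lt_trans (ler_norm _) _.
  by apply: hN0; exact: (leq_trans N0N).
- move=> w wr sw; apply: le_trans (cmodD _ _) _; rewrite !cmodN; apply: lerD.
    by apply: hM; rewrite // wr.
  have ws : cmod (x0%:C - w) <= s.
    have -> : x0%:C - w = c%:C - (w - c%:C) by rewrite -c2 rmorphD/=; ring.
    apply: le_trans (cmodD _ _) _; rewrite cmodN wr cmod_real ger0_norm//; lra.
  have wx : cmod (x0%:C - w) < x0 by lra.
  rewrite -[T _ _](subrK (Phi 0 0)%:C) addrC; apply: le_trans (cmodD _ _) _.
  rewrite cmod_real lerD2l; apply: le_trans (T_bound N wx) _.
  rewrite lerD2r; apply: (@is_derive_ge0_le _ _ (Phi 1)) => // u /andP[u0 us].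
    by apply: dPhi; rewrite (le_trans _ u0) ?cmod_ge0//; lra.
  by apply: Phi_ge0; rewrite (le_trans _ u0) ?cmod_ge0//; lra.
Qed.


Let mid_disc e : 0 < e < x0 -> cmod (e%:C - (x0 / 2)%:C) < x0 / 2.
Proof. by move=> he; rewrite -rmorphB/= cmod_real ltr_norml; lra. Qed.

(** In the limit [T_bound] reads |f x0 - v z| <= f x0 - f (x0 - |x0 - z|); compare real parts. *)
Lemma BF_Re_ge z : cmod (z - (x0 / 2)%:C) < x0 / 2 -> cmod (x0%:C - z) < x0 ->
  f (x0 - cmod (x0%:C - z)) <= complex.Re (v z).
Proof.
move=> zc wx; apply/ler_addgt0Pr => e e0.
have [N0 /(_ N0 (leqnn N0)) hN] := BF_taylor zc e0.
have h2 := T_bound N0 wx.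
have : cmod (- v z - (Phi 0 0)%:C) <= e + (Phi 0 (cmod (x0%:C - z)) - Phi 0 0).
  apply: le_trans (lerD hN h2); apply: le_trans (cmodD _ _).
  by rewrite le_eqVlt; apply/orP; left; apply/eqP; congr cmod; ring.
move=> /(le_trans (cmod_Re _)); rewrite ReB /Phi expr1 !mulN1r subr0 /=.
have -> : complex.Re (- v z) = - complex.Re (v z) by case: (v z).
by rewrite ler_norml; lra.
Qed.

Let T_sub N w y : cmod w <= y -> 0 <= y < x0 ->
  cmod (T N.+1 y%:C - T N.+1 w) <= Phi 1 y * cmod (y%:C - w).
Proof.
move=> wy yx; have /andP[y0 _] := yx.
rewrite /T -sumrB; apply: le_trans (cmod_sum _) _.
apply: (@le_trans _ _ (taylor_sum Phi 1 N y * cmod (y%:C - w))).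
  rewrite taylor_sumS mulr_suml.
  apply: ler_sum => -[[|n] hn] _ /=.
    by rewrite !expr0 subrr cmod0 !(mul0r, mulr0).
  rewrite -mulrBr cmodM cmod_real ger0_norm// -[leRHS]mulrA ler_wpM2l//.
  exact: (cmod_subX n.+1 wy).
rewrite ler_wpM2r ?cmod_ge0// -subr_ge0.
exact: (@taylor_rem_ge0 _ _ _ dPhi Phi_ge0 1 N y).
Qed.

Let T_sub2 N w y : cmod w <= y -> 0 <= y < x0 ->
  cmod (T N.+2 y%:C - T N.+2 w - (taylor_sum Phi 1 N.+1 y)%:C * (y%:C - w)) <=
  Phi 2 y / 2 * cmod (y%:C - w) ^+ 2.
Proof.
move=> wy yx; have /andP[y0 _] := yx.
rewrite taylor_sumS.
rewrite /T -sumrB rmorph_sum/= mulr_suml -sumrB; apply: le_trans (cmod_sum _) _.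
apply: (@le_trans _ _ (taylor_sum Phi 2 N y / 2 * cmod (y%:C - w) ^+ 2)).
  rewrite taylor_sumSS !mulr_suml.
  apply: ler_sum => -[[|n] hn] _ /=.
    by rewrite !expr0 subrr !(mul0r, mulr0, rmorph0) subr0 cmod0.
  rewrite [(_ * (_ * _))%:C]rmorphM/= -[X in _ - X]mulrA -!mulrBr cmodM cmod_real.
  rewrite ger0_norm// -[leRHS]mulrA -[leRHS]mulrA ler_wpM2l// [leRHS]mulrA.
  exact: (cmod_subX2 n.+1 wy).
rewrite ler_wpM2r ?exprn_ge0 ?cmod_ge0// ler_pM2r// -subr_ge0.
exact: (@taylor_rem_ge0 _ _ _ dPhi Phi_ge0 2 N y).
Qed.

Let Phi1E e : Phi 1 (x0 - e) = f^`()%classic e.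
Proof. by rewrite /Phi subKr sqrrN expr1n mul1r. Qed.

Let Phi2E e : Phi 2 (x0 - e) = - f^`(2)%classic e.
Proof. by rewrite /Phi subKr !exprS expr0; ring. Qed.

Lemma BF_lipschitz_at z e : cmod (z - (x0 / 2)%:C) < x0 / 2 -> 0 < e < x0 ->
  cmod (x0%:C - z) <= x0 - e ->
  cmod (v z - (f e)%:C) <= f^`()%classic e * cmod (z - e%:C).
Proof.
move=> zc he wy; have /andP[e0 ex] := he; apply/ler_addgt0Pr => d d0.
have d20 : 0 < d / 2 by lra.
have [N1 h1] := BF_taylor zc d20; have [N2 h2] := BF_taylor (mid_disc he) d20.
pose N := maxn N1 N2.
have {h1} k1 := h1 N (leq_maxl _ _); have {h2} k2 := h2 N (leq_maxr _ _).
have yx : 0 <= x0 - e < x0 by lra.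
have := T_sub N wy yx; rewrite Phi1E.
have -> : (x0 - e)%:C - (x0%:C - z) = z - e%:C by rewrite rmorphB/=; ring.
move=> k3; rewrite -rmorphB/= BF_real// in k2.
have -> : v z - (f e)%:C = - (- v z - T N.+1 (x0%:C - z)) +
    (- (f e)%:C - T N.+1 (x0 - e)%:C) +
    (T N.+1 (x0 - e)%:C - T N.+1 (x0%:C - z)) by ring.
apply: le_trans (cmodD _ _) _; apply: le_trans (lerD (cmodD _ _) (lexx _)) _.
by rewrite cmodN; lra.
Qed.

(** Besides T at z and at e, the linear coefficient in [T_sub2], a Taylor polynomial of [Phi 1],
    must converge, its limit being f'(e). This is [taylor_rem_scale] between y = x0 - e and some r
    in (y, x0). *)
Lemma BF_taylor1_at z e : cmod (z - (x0 / 2)%:C) < x0 / 2 -> 0 < e < x0 ->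
  cmod (x0%:C - z) <= x0 - e ->
  cmod (v z - (f e)%:C - (f^`()%classic e)%:C * (z - e%:C)) <=
    - f^`(2)%classic e / 2 * cmod (z - e%:C) ^+ 2.
Proof.
move=> zc he wy; have /andP[e0 ex] := he; apply/ler_addgt0Pr => d d0.
have d30 : 0 < d / 3 by lra.
have [N1 h1] := BF_taylor zc d30; have [N2 h2] := BF_taylor (mid_disc he) d30.
have yx : 0 <= x0 - e < x0 by lra.
pose y := x0 - e; pose r := (y + x0) / 2.
have yr : y < r by rewrite /r /y; lra.
have r0 : 0 < r by rewrite /r /y; lra.
have rx : 0 <= r < x0 by rewrite /r /y; lra.
have y0 : 0 <= y by rewrite /y; lra.
have q1 : `|y / r| < 1 by rewrite ger0_norm ?divr_ge0 ?ltr_pdivrMr ?mul1r//; lra.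
have m0 := cmod_ge0 (z - e%:C).
have d40 : 0 < d / 3 / (cmod (z - e%:C) + 1) by rewrite divr_gt0//; lra.
have [N3 h3] := geometric_lt (Phi 1 r) q1 d40.
pose N := maxn (maxn N1 N2) N3.
have N1N : (N1 <= N.+1)%N := leqW (leq_trans (leq_maxl N1 N2) (leq_maxl _ N3)).
have N2N : (N2 <= N.+1)%N := leqW (leq_trans (leq_maxr N1 N2) (leq_maxl _ N3)).
have N3N : (N3 <= N.+1)%N := leqW (leq_maxr _ N3).
have {h1} k1 := h1 _ N1N; have {h2} k2 := h2 _ N2N; have {h3} k3 := h3 _ N3N.
have := T_sub2 N wy yx; rewrite Phi2E.
have yw : (x0 - e)%:C - (x0%:C - z) = z - e%:C by rewrite rmorphB/=; ring.
rewrite yw => k4; rewrite -rmorphB/= BF_real// in k2.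
set S := taylor_sum Phi 1 N.+1 (x0 - e) in k4.
have k5 : cmod ((f^`()%classic e - S)%:C * (z - e%:C)) <= d / 3.
  rewrite cmodM cmod_real -Phi1E.
  have S0 : 0 <= Phi 1 (x0 - e) - S.
    exact: (@taylor_rem_ge0 _ _ _ dPhi Phi_ge0 1 N.+1).
  rewrite ger0_norm//.
  have hS : Phi 1 (x0 - e) - S <= d / 3 / (cmod (z - e%:C) + 1).
    have q01 : 0 <= y / r <= 1 by rewrite divr_ge0 ?ler_pdivrMr ?mul1r//=; lra.
    have yE : x0 - e = y / r * r by rewrite divfK// gt_eqF.
    have := @taylor_rem_scale _ _ _ dPhi Phi_ge0 1 N.+1 r _ isT rx q01.
    rewrite -yE => /le_trans; apply; apply: ltW; apply: le_lt_trans k3.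
    apply: le_trans (ler_norm _) ; rewrite mulrC ler_wpM2r//.
      by rewrite exprn_ge0//; case/andP: q01.
    rewrite /taylor_rem gerBl /taylor_sum sumr_ge0// => n _.
    apply: mulr_ge0; last by rewrite exprn_ge0//; case/andP: rx.
    by apply: divr_ge0 => //; apply: (@Phi_ge0 n 0); rewrite lexx.
  apply: (@le_trans _ _ (d / 3 / (cmod (z - e%:C) + 1) * (cmod (z - e%:C) + 1))).
    by apply: ler_pM => //; lra.
  by rewrite divfK// gt_eqF//; lra.
have -> : v z - (f e)%:C - (f^`()%classic e)%:C * (z - e%:C) =
    - (- v z - T N.+2 (x0%:C - z)) +
    (- (f e)%:C - T N.+2 (x0 - e)%:C) +
    (T N.+2 (x0 - e)%:C - T N.+2 (x0%:C - z) - S%:C * (z - e%:C)) -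
    (f^`()%classic e - S)%:C * (z - e%:C) by rewrite rmorphB/=; ring.
apply: le_trans (cmodD _ _) _; apply: le_trans (lerD (cmodD _ _) (lexx _)) _.
apply: le_trans (lerD (lerD (cmodD _ _) (lexx _)) (lexx _)) _.
by rewrite !cmodN; lra.
Qed.

End BernsteinTaylor.

Section BernsteinBounds.
Variables (R : realType) (v : R[i] -> R[i]).
Hypothesis hv : BF v.
Implicit Types (z w : R[i]) (x y e : R).
Local Open Scope complex_scope.
Let f : R -> R := real_trace v.

(** After squaring, the squares of x0 cancel and the conditions become linear in x0: m < x0 a and m
    <= x0 (a - e) suffice. The case e = 0 serves [BF_Re_gt0]. *)
Lemma large_disc z e : 0 <= e < complex.Re z -> exists x0 : R,
  [/\ e < x0, cmod (z - (x0 / 2)%:C) < x0 / 2, cmod (x0%:C - z) < x0 &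
    cmod (x0%:C - z) <= x0 - e].
Proof.
move=> /andP[e0 ez]; pose a := complex.Re z; pose m := cmod z ^+ 2.
have m0 : 0 <= m by exact: sqr_ge0.
have a0 : 0 < a by exact: le_lt_trans ez.
have ae : 0 < a - e by rewrite subr_gt0.
pose x0 := 1 + e + m / a + m / (a - e).
have t1 : 0 <= m / a by rewrite divr_ge0// ltW.
have t2 : 0 <= m / (a - e) by rewrite divr_ge0// ltW.
have h1 : m < x0 * a.
  by rewrite -ltr_pdivrMr// /x0; lra.
have h2 : m <= x0 * (a - e).
  by rewrite -ler_pdivrMr// /x0; lra.
have x00 : 0 < x0 by rewrite /x0; lra.
have ex : e < x0 by rewrite /x0; lra.
have d1 (c : R) : cmod (z - c%:C) ^+ 2 = m - 2 * c * a + c ^+ 2.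
  by rewrite /m !cmod_sqr ReB ImB /= -/a; ring.
exists x0; split => //.
- rewrite -ltr_sqr ?nnegrE ?cmod_ge0//; last by lra.
  by rewrite d1; lra.
- rewrite cmodB -ltr_sqr ?nnegrE ?cmod_ge0//; last by lra.
  by rewrite d1; nra.
- rewrite cmodB -ler_sqr ?nnegrE ?cmod_ge0//; last by lra.
  rewrite d1; have : 0 <= e ^+ 2 by exact: sqr_ge0.
  by rewrite sqrrB; nra.
Qed.

Lemma BF_deriv_ge0 x : 0 < x -> 0 <= f^`()%classic x.
Proof. by move=> /(BF_sign hv 0); rewrite sqrrN expr1n mul1r. Qed.

Lemma BF_deriv2_le0 x : 0 < x -> f^`(2)%classic x <= 0.
Proof.
by move=> /(BF_sign hv 1); rewrite -signr_odd expr1 mulN1r oppr_ge0.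
Qed.

Lemma BF_deriv3_ge0 x : 0 < x -> 0 <= f^`(3)%classic x.
Proof.
by move=> /(BF_sign hv 2); rewrite -signr_odd expr0 mul1r.
Qed.

Let monotone_of_derive (g dg : R -> R) : (forall x, 0 < x -> is_derive x 1 g (dg x)) ->
  (forall x, 0 < x -> 0 <= dg x) -> forall x y, 0 < x -> x <= y -> g x <= g y.
Proof.
move=> dgP dg0 x y x0 xy; apply: (is_derive_ge0_le xy) => t /andP[xt _].
  by apply: dgP; exact: lt_le_trans xt.
by apply: dg0; exact: lt_le_trans xt.
Qed.

Lemma BF_le x y : 0 < x -> x <= y -> f x <= f y.
Proof. exact: monotone_of_derive (BF_is_derive hv 0) BF_deriv_ge0 x y. Qed.

Lemma BF_deriv2_le x y : 0 < x -> x <= y -> f^`(2)%classic x <= f^`(2)%classic y.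
Proof. exact: monotone_of_derive (BF_is_derive hv 2) BF_deriv3_ge0 x y. Qed.

Lemma BF_deriv_ge x y : 0 < x -> x <= y -> f^`()%classic y <= f^`()%classic x.
Proof.
move=> x0 xy; rewrite -lerN2.
apply: (@monotone_of_derive (fun t => - f^`()%classic t) (fun t => - f^`(2)%classic t)) => //.
  by move=> t t0; apply: is_deriveN; exact: (BF_is_derive hv 1).
by move=> t t0; rewrite oppr_ge0 BF_deriv2_le0.
Qed.

Let tangent_le (g dg : R -> R) : (forall x, 0 < x -> is_derive x 1 g (dg x)) ->
  (forall x y, 0 < x -> x <= y -> dg y <= dg x) ->
  forall x y, 0 < x -> x <= y -> g y - g x <= dg x * (y - x).
Proof.
move=> dgP dg0 x y x0; rewrite le_eqVlt => /predU1P[<-|xy].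
  by rewrite !subrr mulr0.
have [| |c] := @MVT R g dg x y xy.
- by move=> t; rewrite in_itv/= => /andP[xt _]; apply: dgP; exact: lt_trans xt.
- apply: derivable_within_continuous => t; rewrite in_itv/= => /andP[xt _].
  by have h := dgP _ (lt_le_trans x0 xt); exact: ex_derive.
rewrite in_itv/= => /andP[xc _] ->; apply: ler_wpM2r; first by rewrite subr_ge0 ltW.
by apply: dg0 => //; exact: ltW.
Qed.

Lemma BF_tangent_le x y : 0 < x -> x <= y -> f y - f x <= f^`()%classic x * (y - x).
Proof. exact: tangent_le (BF_is_derive hv 0) BF_deriv_ge x y. Qed.

(** A zero at x spreads to (0, x] by monotonicity, so f' vanishes somewhere below x and f' x <= 0.
    The tangent inequality then gives f <= 0 beyond x as well, against the point where v does not
    vanish. *)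
Lemma BF_gt0 x : 0 < x -> 0 < f x.
Proof.
move=> x0; rewrite lt_neqAle eq_sym (BF_ge0 hv x0) andbT; apply/negP => /eqP fx.
case: (hv) => _ _ _ [x1 x10]; rewrite BF_real//.
have [xx1|/ltW x1x] := leP x x1.
  have f0 t : 0 < t -> t <= x -> f t = 0.
    move=> t0 tx; apply/eqP; rewrite eq_le (BF_ge0 hv t0) andbT -fx.
    exact: BF_le.
  have x20 : 0 < x / 2 by lra.
  have x2x : x / 2 <= x by lra.
  have fd : f^`()%classic x <= 0.
    have [| | |c] := @MVT R f f^`()%classic (x / 2) x; first lra.
    - by move=> t; rewrite in_itv/= => /andP[xt _]; apply: (BF_is_derive hv 0); lra.
    - apply: derivable_within_continuous => t; rewrite in_itv/= => /andP[xt _].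
      by have := BF_is_derive hv 0 (lt_le_trans x20 xt) => h; exact: ex_derive.
    rewrite in_itv/= => /andP[cx xc]; rewrite !f0// subrr => /esym/eqP.
    rewrite mulf_eq0 => /orP[/eqP dc|]; last by rewrite subr_eq0 gt_eqF//; lra.
    by rewrite -dc; apply: BF_deriv_ge; lra.
  have := BF_tangent_le x0 xx1; rewrite fx subr0 => h.
  have : f x1 <= 0 by apply: le_trans h _; apply: mulr_le0_ge0 => //; lra.
  have := BF_ge0 hv x10; rewrite -/f => ? ?.
  have fx1 : f x1 = 0 by apply/eqP; rewrite eq_le; apply/andP.
  by rewrite fx1 rmorph0 eqxx.
have := BF_le x10 x1x; rewrite fx => h.
have := BF_ge0 hv x10; rewrite -/f => ?.
have fx1 : f x1 = 0 by apply/eqP; rewrite eq_le; apply/andP.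
by rewrite fx1 rmorph0 eqxx.
Qed.

Lemma BF_Re_gt0 z : 0 < complex.Re z -> 0 < complex.Re (v z).
Proof.
move=> z0; have [|x0 [x00 zc wx _]] := @large_disc z 0; first by rewrite lexx.
apply: lt_le_trans (BF_Re_ge hv x00 zc wx); apply: BF_gt0; lra.
Qed.

Lemma BF_lipschitz z e : 0 < e < complex.Re z ->
  cmod (v z - (f e)%:C) <= f^`()%classic e * cmod (z - e%:C).
Proof.
move=> /andP[e0 ez]; have [|x0 [ex zc wx we]] := @large_disc z e; first by rewrite ltW.
by apply: (BF_lipschitz_at hv (lt_trans e0 ex) zc) => //; rewrite e0.
Qed.

Lemma BF_taylor1 z e : 0 < e < complex.Re z ->
  cmod (v z - (f e)%:C - (f^`()%classic e)%:C * (z - e%:C)) <=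
    - f^`(2)%classic e / 2 * cmod (z - e%:C) ^+ 2.
Proof.
move=> /andP[e0 ez]; have [|x0 [ex zc wx we]] := @large_disc z e; first by rewrite ltW.
by apply: (BF_taylor1_at hv (lt_trans e0 ex) zc) => //; rewrite e0.
Qed.

End BernsteinBounds.

(** * Composition of Bernstein functions fixing zero *)

Section LimitsAtZero.
Variables (R : realType) (v : R[i] -> R[i]).
Hypothesis hv : BF v.
Implicit Types (x y e : R).
Let f : R -> R := real_trace v.

(** [deriv_at0] is a [lim], whose value carries information only once convergence is known;
    monotonicity supplies it in the extended reals. *)
Let monotone_limit (g : R -> R) (l : \bar R) :
  (forall x y, 0 < x -> x <= y -> g x <= g y) \/
  (forall x y, 0 < x -> x <= y -> g y <= g x) ->
  lim ((g x)%:E @[x --> 0^'+]) = l -> l \is a fin_num ->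
  g x @[x --> 0^'+] --> fine l.
Proof.
move=> mg gl lfin.
have cg : cvg ((g x)%:E @[x --> 0^'+]).
  have [ndg|nig] := mg.
    apply: nondecreasing_at_right_is_cvge; near=> x => s t.
    by rewrite !in_itv/= => /andP[s0 _] _ st; rewrite lee_fin; exact: ndg.
  apply: nonincreasing_at_right_is_cvge; near=> x => s t.
  by rewrite !in_itv/= => /andP[s0 _] _ st; rewrite lee_fin; exact: nig.
have : (g x)%:E @[x --> 0^'+] --> (fine l)%:E by rewrite fineK// -gl.
by move=> /fine_cvg.
Unshelve. all: by end_near. Qed.

Lemma BF_cvg0 : deriv_at0 0 v = 0%E -> f x @[x --> 0^'+] --> (0 : R).
Proof.
move=> v0; apply: (@monotone_limit f 0%E) => //.
by left => x y x0 xy; exact: (BF_le hv).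
Qed.

Lemma BF_deriv_cvg0 : deriv_at0 1 v \is a fin_num ->
  f^`()%classic x @[x --> 0^'+] --> fine (deriv_at0 1 v).
Proof.
move=> v1; apply: monotone_limit v1 => //.
by right => x y x0 xy; exact: (BF_deriv_ge hv).
Qed.

Lemma BF_deriv2_cvg0 : deriv_at0 2 v \is a fin_num ->
  f^`(2)%classic x @[x --> 0^'+] --> fine (deriv_at0 2 v).
Proof.
move=> v1; apply: monotone_limit v1 => //.
by left => x y x0 xy; exact: (BF_deriv2_le hv).
Qed.

(** Concavity gives f 1 <= f x + f' x (1 - x); as x -> 0+ this becomes f 1 <= f'(0), and f 1 > 0. *)
Lemma BF_deriv_at0_gt0 : deriv_at0 0 v = 0%E -> deriv_at0 1 v \is a fin_num ->
  0 < fine (deriv_at0 1 v).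
Proof.
move=> /BF_cvg0 f0 /BF_deriv_cvg0; set a := fine _ => fa.
have f1 : 0 < f 1 by exact: BF_gt0.
suff : f 1 <= a by exact: lt_le_trans.
have fH : f x + f^`()%classic x * 1 @[x --> 0^'+] --> 0 + a * 1.
  by apply: cvgD => //; apply: cvgM => //; exact: cvg_cst.
rewrite add0r mulr1 in fH; apply: (cvgr_to_ge fH); near=> x.
have x0 : 0 < x by near: x; exact: nbhs_right_gt.
have x1 : x <= 1 by near: x; apply: nbhs_right_le.
have := BF_tangent_le hv x0 x1; rewrite -/f => h.
have : f^`()%classic x * (1 - x) <= f^`()%classic x * 1.
  by apply: ler_wpM2l; [exact: BF_deriv_ge0|lra].
lra.
Unshelve. all: by end_near. Qed.

End LimitsAtZero.

Section CompositionEstimate.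
Variables (R : realType) (v1 v2 v3 : R[i] -> R[i]).
Hypotheses (h1 : BF v1) (h2 : BF v2) (h3 : BF v3).
Hypothesis v3E : forall z, half_plane z -> v3 z = v2 (v1 z).
Hypotheses (v10 : deriv_at0 0 v1 = 0%E) (v30 : deriv_at0 0 v3 = 0%E).
Hypotheses (v11 : deriv_at0 1 v1 \is a fin_num) (v31 : deriv_at0 1 v3 \is a fin_num).
Local Open Scope complex_scope.
Let f : R -> R := real_trace v1.
Let g : R -> R := real_trace v2.
Let F : R -> R := real_trace v3.
Let a1 := fine (deriv_at0 1 v1).
Let a3 := fine (deriv_at0 1 v3).
Let b1 := fine (deriv_at0 2 v1).
Let b3 := fine (deriv_at0 2 v3).

Let comp x : 0 < x -> F x = g (f x).
Proof.
move=> x0; rewrite /F /g /real_trace v3E//.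
by rewrite (BF_real h1 x0).
Qed.

Let comp_derive x : 0 < x -> F^`()%classic x = g^`()%classic (f x) * f^`()%classic x.
Proof.
move=> x0; have fx := BF_gt0 h1 x0.
have dgf : is_derive x 1 (g \o f) (g^`()%classic (f x) * f^`()%classic x).
  by apply: is_derive1_comp; [exact: (BF_is_derive h2 0)|exact: (BF_is_derive h1 0)].
rewrite derive1E; rewrite -(@derive_val _ _ _ _ _ _ _ dgf).
apply: near_eq_derive; near=> y; apply: comp.
by near: y; exact: lt_nbhsr.
Unshelve. all: by end_near. Qed.

Let comp_derive2 x : 0 < x -> F^`(2)%classic x =
  g^`(2)%classic (f x) * f^`()%classic x ^+ 2 + g^`()%classic (f x) * f^`(2)%classic x.
Proof.
move=> x0; have fx := BF_gt0 h1 x0.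
have dgf : is_derive x 1 (g^`()%classic \o f) (g^`(2)%classic (f x) * f^`()%classic x).
  by apply: is_derive1_comp; [exact: (BF_is_derive h2 1)|exact: (BF_is_derive h1 0)].
have dM := is_deriveM dgf (BF_is_derive h1 1 x0).
rewrite derive1nS derive1E.
have -> : 'D_1 F^`()%classic x = 'D_1 ((g^`()%classic \o f) * f^`()%classic) x.
  apply: near_eq_derive; near=> y; apply: comp_derive.
  by near: y; exact: lt_nbhsr.
apply: (etrans (@derive_val _ _ _ _ _ _ _ dM)).
transitivity (g^`()%classic (f x) * f^`(2)%classic x +
  f^`()%classic x * (g^`(2)%classic (f x) * f^`()%classic x)) => //.
by rewrite addrC mulrC expr2 -mulrA.
Unshelve. all: by end_near. Qed.

Let a1_gt0 : 0 < a1. Proof. exact: BF_deriv_at0_gt0. Qed.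
(** The chain-rule expression for g' at f x; its limit a3 / a1 plays the role of v2'(0). *)
Let q x := F^`()%classic x / f^`()%classic x.
Let q_cvg : q x @[x --> 0^'+] --> a3 / a1.
Proof.
apply: cvgM; first exact: BF_deriv_cvg0.
by apply: cvgV; [rewrite gt_eqF|exact: BF_deriv_cvg0].
Qed.

Let q_comp : \forall x \near 0^'+, g^`()%classic (f x) = q x.
Proof.
near=> x; have x0 : 0 < x by near: x; exact: nbhs_right_gt.
rewrite /q comp_derive// mulfK// gt_eqF//.
by near: x; exact: (cvgr_gt _ (BF_deriv_cvg0 h1 v11) 0 a1_gt0).
Unshelve. all: by end_near. Qed.

(** [BF_lipschitz] at e = f x, where v2 takes the value F x, followed by x -> 0+. *)
Lemma BF_comp_le z : half_plane z -> cmod (v2 z) <= a3 / a1 * cmod z.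
Proof.
move=> z0; pose m := cmod z.
have H : F x + q x * (m + f x) @[x --> 0^'+] --> 0 + a3 / a1 * (m + 0).
  apply: cvgD; first exact: BF_cvg0.
  by apply: cvgM => //; apply: cvgD; [exact: cvg_cst|exact: BF_cvg0].
rewrite add0r addr0 in H; apply: (cvgr_to_ge H); near=> x.
have x0 : 0 < x by near: x; exact: nbhs_right_gt.
have fx := BF_gt0 h1 x0.
have fz : f x < complex.Re z by near: x; exact: (cvgr_lt _ (BF_cvg0 h1 v10)).
have gx : g^`()%classic (f x) = q x by near: x; exact: q_comp.
have Fx : 0 <= F x by apply: BF_ge0.
have q0 : 0 <= q x by rewrite -gx; apply: (BF_deriv_ge0 h2).
have fz' : 0 < f x < complex.Re z by rewrite fx.
have := BF_lipschitz h2 fz'; rewrite -/g -comp// gx => h.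
rewrite -[v2 z](subrK (F x)%:C) addrC; apply: le_trans (cmodD _ _) _.
rewrite cmod_real ger0_norm// lerD2l; apply: le_trans h _; apply: ler_wpM2l => //.
by apply: le_trans (cmodD _ _) _; rewrite cmodN cmod_real gtr0_norm.
Unshelve. all: by end_near. Qed.

Hypotheses (v12 : deriv_at0 2 v1 \is a fin_num) (v32 : deriv_at0 2 v3 \is a fin_num).

(** [BF_taylor1] at e = f x, with the second-order chain rule solved for g''(f x), which is - b x
    near 0. *)
Lemma BF_comp_near z : half_plane z ->
  cmod (v2 z - (a3 / a1)%:C * z) <=
    `|b3 - a3 / a1 * b1| / a1 ^+ 2 / 2 * cmod z ^+ 2.
Proof.
move=> z0; pose m := cmod z.
pose b x := - (F^`(2)%classic x - q x * f^`(2)%classic x) / f^`()%classic x ^+ 2.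
have fa := BF_deriv_cvg0 h1 v11.
have fb := BF_deriv2_cvg0 h1 v12; have Fb := BF_deriv2_cvg0 h3 v32.
have f0 := BF_cvg0 h1 v10; have F0 := BF_cvg0 h3 v30.
have bB : b x @[x --> 0^'+] --> - (b3 - a3 / a1 * b1) / a1 ^+ 2.
  apply: cvgM.
    exact: (cvgN (cvgB Fb (cvgM q_cvg fb))).
  by apply: cvgV; [rewrite expf_neq0// gt_eqF|exact: (cvgM fa fa)].
have mc : m + f x @[x --> 0^'+] --> m + 0 by apply: cvgD => //; exact: cvg_cst.
(* The summands bound the quadratic remainder, the value F x, the change of slope from q x to a3 /
   a1, and the shift of the base point; all but the first vanish in the limit. *)
have H : b x / 2 * ((m + f x) * (m + f x)) + F x + (`|q x - a3 / a1| * m + q x * f x)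
    @[x --> 0^'+] -->
    - (b3 - a3 / a1 * b1) / a1 ^+ 2 / 2 * ((m + 0) * (m + 0)) + 0 +
    (`|a3 / a1 - a3 / a1| * m + a3 / a1 * 0).
  apply: cvgD.
    apply: cvgD F0; apply: cvgM (cvgM mc mc).
    exact: (cvgM bB (cvg_cst _)).
  apply: cvgD (cvgM q_cvg f0); apply: cvgM (cvg_cst _).
  exact: (cvg_norm (cvgB q_cvg (cvg_cst _))).
apply: (@le_trans _ _ (- (b3 - a3 / a1 * b1) / a1 ^+ 2 / 2 * m ^+ 2)); last first.
  rewrite ler_wpM2r ?sqr_ge0// ler_pM2r// ler_wpM2r//; first by rewrite invr_ge0 sqr_ge0.
  by rewrite -normrN ler_norm.
rewrite !addr0 subrr normr0 mul0r mulr0 !addr0 in H.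
apply: (cvgr_to_ge H); near=> x.
have x0 : 0 < x by near: x; exact: nbhs_right_gt.
have fx := BF_gt0 h1 x0.
have fz : f x < complex.Re z by near: x; exact: (cvgr_lt _ (BF_cvg0 h1 v10)).
have gx : g^`()%classic (f x) = q x by near: x; exact: q_comp.
have f'x : 0 < f^`()%classic x by near: x; exact: (cvgr_gt _ fa 0 a1_gt0).
have Fx : 0 <= F x by apply: BF_ge0.
have q0 : 0 <= q x by rewrite -gx; apply: (BF_deriv_ge0 h2).
have g2x : - g^`(2)%classic (f x) = b x.
  rewrite /b comp_derive2// gx.
  by rewrite addrK mulNr mulfK// expf_neq0// gt_eqF.
have fz' : 0 < f x < complex.Re z by rewrite fx.
have := BF_taylor1 h2 fz'; rewrite -/g -comp// gx g2x => h.
have b0 : 0 <= b x by rewrite -g2x oppr_ge0; exact: (BF_deriv2_le0 h2).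
have -> : v2 z - (a3 / a1)%:C * z =
   (v2 z - (F x)%:C - (q x)%:C * (z - (f x)%:C)) + (F x)%:C +
   ((q x - a3 / a1)%:C * z - (q x)%:C * (f x)%:C).
  by rewrite rmorphB/=; ring.
apply: le_trans (cmodD _ _) _; apply: lerD.
  apply: le_trans (cmodD _ _) _; rewrite [cmod (F x)%:C]cmod_real ger0_norm// lerD2r.
  apply: le_trans h _; apply: ler_wpM2l; first by rewrite divr_ge0.
  have : cmod (z - (f x)%:C) <= m + f x.
    by apply: le_trans (cmodD _ _) _; rewrite cmodN cmod_real gtr0_norm.
  by move=> h; rewrite expr2 ler_pM ?cmod_ge0.
apply: le_trans (cmodD _ _) _; rewrite cmodN !cmodM !cmod_real.
by rewrite (ger0_norm q0) (gtr0_norm fx).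
Unshelve. all: by end_near. Qed.

End CompositionEstimate.

(** * Densities of absolutely continuous functions *)

Section AbsoluteContinuity.
Variable R : realType.
Implicit Types (a b x y e d : R) (g : R -> R) (p q : R * R) (s : seq (R * R)).

Let disj p q := (p.2 <= q.1) || (q.2 <= p.1).

Definition disjoint_intervals a b s :=
  all (fun p => [&& a <= p.1, p.1 < p.2 & p.2 <= b]) s && pairwise disj s.

Definition total_length s := \sum_(p <- s) (p.2 - p.1).
Definition total_increment g s := \sum_(p <- s) `|g p.2 - g p.1|.

(** Lists can be refined by recursion, unlike indexed families, and the weak inequality survives
    suprema. *)
Lemma abs_continuous_seq a b g : abs_continuous a b g -> forall e, 0 < e ->
  exists2 d : R, 0 < d & forall s, disjoint_intervals a b s ->
    total_length s < d -> total_increment g s <= e.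
Proof.
move=> ac e e0; have [d d0 hd] := ac e e0; exists d => // s /andP[als pws] ls.
pose x (i : 'I_(size s)) := (nth (0, 0) s i).1.
pose y (i : 'I_(size s)) := (nth (0, 0) s i).2.
have := hd (size s) x y; rewrite /total_increment (big_nth (0, 0)) big_mkord.
move=> h; apply/ltW/h.
- move=> i; have /and3P[? ? ?] := all_nthP (0, 0) als i (ltn_ord i).
  by split.
- apply/trivIsetP => i j _ _ ij; apply/seteqP; split=> // r [].
  rewrite /= !in_itv/= => /andP[r1 r2] /andP[r3 r4].
  wlog lij : i j ij r1 r2 r3 r4 / (i < j)%N.
    move=> H; case: (ltngtP i j) => [|ji|/val_inj ijE].
    - exact: H.
    - by apply: (H j i) => //; rewrite eq_sym.
    - by rewrite ijE eqxx in ij.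
  have /orP[] := pairwiseP (0, 0) pws i j (ltn_ord i) (ltn_ord j) lij.
    by rewrite -/(x j) -/(y i); lra.
  by rewrite -/(x i) -/(y j); lra.
- by move: ls; rewrite /total_length (big_nth (0, 0)) big_mkord.
Qed.

(** [l] lists the partition points after x, the format of [itv_partition]. *)
Fixpoint steps x (l : seq R) : seq (R * R) :=
  if l is c :: l' then (x, c) :: steps c l' else [::].

Lemma stepsP x y l : itv_partition x y l ->
  disjoint_intervals x y (steps x l) /\ total_length (steps x l) = y - x.
Proof.
rewrite /itv_partition /disjoint_intervals /total_length.
elim: l x => [|c l IH] x /=.
  by move=> [_ /eqP ->]; rewrite big_nil subrr.
move=> [/andP[xc pl] lE]; have [/andP[al pw] tl] := IH c (conj pl lE).
have cy : c <= y.
  have := order_path_min (@lt_trans _ _) pl.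
  case: l lE {pl al pw tl IH} => [/= /eqP -> //|c' l /eqP <- /allP /(_ (last c' l))].
  by rewrite mem_last => /(_ isT)/ltW.
rewrite big_cons tl; split; last by rewrite /=; ring.
rewrite lexx xc cy /=; apply/and3P; split => //.
  apply: sub_all al => p /and3P[h1 h2 h3]; apply/and3P; split => //.
  exact: le_trans (ltW xc) h1.
by apply: sub_all al => p /and3P[h _ _]; rewrite /disj/= h.
Qed.

Lemma variation_steps g x y l : variation x y g l = total_increment g (steps x l).
Proof.
rewrite /variation /total_increment; elim: l x => [|c l IH] x /=.
  by rewrite big_nil big_geq.
by rewrite big_nat_recl//= big_cons -IH.
Qed.

Let disj_sym p q : disj p q = disj q p.
Proof. by rewrite /disj orbC. Qed.

Let total_length_cat s1 s2 : total_length (s1 ++ s2) = total_length s1 + total_length s2.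
Proof. by rewrite /total_length big_cat. Qed.

Let total_length_cons p s : total_length (p :: s) = (p.2 - p.1) + total_length s.
Proof. by rewrite /total_length big_cons. Qed.

(** Shaped for the induction of [total_variation_sum_le], in which an interval leaves the head of
    the first list and its steps join the second. *)
Let disjoint_refine a b p s1 s2 l :
  itv_partition p.1 p.2 l -> disjoint_intervals a b ((p :: s1) ++ s2) ->
  disjoint_intervals a b (s1 ++ (steps p.1 l ++ s2)).
Proof.
move=> /stepsP[/andP[al pl] _].
rewrite /disjoint_intervals /= !all_cat => /andP[/and3P[/and3P[ap p12 pb] a1 a2]].
rewrite !pairwise_cat allrel_catr => /andP[/andP[d1 d2] /and3P[d12 pw1 pw2]].
have sub q r : r \in steps p.1 l -> disj p q -> disj r q.
  move=> rl; have /and3P[r1 r2 r3] := allP al _ rl.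
  by rewrite /disj => /orP[h|h]; apply/orP; [left|right]; lra.
rewrite a1 a2 andbT /= d12 pw1 pl pw2 /= !andbT; apply/and3P; split.
- by apply: sub_all al => q /and3P[h1 -> h3]; rewrite /=; apply/andP; split; lra.
- apply/allrelP => q r qs rl; rewrite disj_sym; apply: sub => //.
  exact: (allP d1).
- by apply/allrelP => r q rl qs; apply: sub => //; exact: (allP d2).
Qed.

(* A family of intervals has its increments replaced by total variations one
   interval at a time: refining an interval by a partition stays in the class
   of families controlled by absolute continuity. *)
Lemma total_variation_sum_le a b g d e :
  (forall s, disjoint_intervals a b s -> total_length s < d ->
    total_increment g s <= e) ->
  forall s1 s2, disjoint_intervals a b (s1 ++ s2) -> total_length (s1 ++ s2) < d ->
  (\sum_(p <- s1) total_variation p.1 p.2 g + (total_increment g s2)%:E <= e%:E)%E.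
Proof.
move=> hd; elim=> [|p s1 IH] s2 ds ls.
  by rewrite big_nil add0e lee_fin; exact: hd.
rewrite big_cons.
have p12 : p.1 <= p.2 by case/andP: ds => /= /andP[/and3P[_ /ltW]].
have part l : itv_partition p.1 p.2 l ->
    (\sum_(p <- s1) total_variation p.1 p.2 g +
     (total_increment g (steps p.1 l ++ s2))%:E <= e%:E)%E.
  move=> pl; apply: IH; first exact: disjoint_refine.
  apply: le_lt_trans ls; rewrite !total_length_cat (stepsP pl).2.
  by rewrite total_length_cons le_eqVlt; apply/orP; left; apply/eqP; ring.
have tv0 : (0 <= \sum_(q <- s1) total_variation q.1 q.2 g)%E.
  rewrite big_seq; apply: sume_ge0 => q qs; apply: total_variation_ge0.
  case/andP: ds => /allP /(_ q); rewrite /= inE mem_cat qs orbT => /(_ isT).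
  by move=> /and3P[_ /ltW].
set A := (\sum_(q <- s1) _)%E in part tv0 *.
have inc0 s : 0 <= total_increment g s by rewrite sumr_ge0.
(* Finiteness allows A to be moved to the other side before the supremum over partitions of p is
   taken; the trivial partition bounds it. *)
have Afin : A \is a fin_num.
  rewrite ge0_fin_numE//.
  have [l pl] : exists l, itv_partition p.1 p.2 l.
    by exists [:: p.2]; apply: itv_partition1; case/andP: ds => /= /andP[/and3P[]].
  apply: le_lt_trans (le_trans _ (part l pl)) (ltry _).
  by rewrite leeDl// lee_fin.
rewrite -addeA -leeBrDr; last by rewrite fin_numD Afin.
apply: ub_ereal_sup => _ [_ [l pl <-] <-].
rewrite leeBrDr; last by rewrite fin_numD Afin.
rewrite variation_steps; apply: le_trans (part l pl).
rewrite /total_increment big_cat/= EFinD addeCA.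
by rewrite le_eqVlt; apply/orP; left; apply/eqP.
Qed.

End AbsoluteContinuity.

Section VariationMajorant.
Variables (R : realType) (a b : R) (g : R -> R).
Hypotheses (ab : a <= b) (acg : abs_continuous a b g).
Implicit Types (x y e d : R) (s : seq (R * R)).
Local Notation TV x y := (total_variation x y g).

Let tv_family_le e : 0 < e -> exists2 d : R, 0 < d &
  forall s, disjoint_intervals a b s -> total_length s < d ->
    (\sum_(p <- s) TV p.1 p.2 <= e%:E)%E.
Proof.
move=> e0; have [d d0 hd] := abs_continuous_seq acg e0; exists d => // s ds ls.
have := total_variation_sum_le hd (s1 := s) (s2 := [::]).
rewrite cats0 => /(_ ds ls); apply: le_trans.
by rewrite leeDl// lee_fin /total_increment big_nil.
Qed.

(** Cut [a, b] into n + 1 equal pieces shorter than the d that belongs to e = 1; each has variation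
    at most 1. *)
Let tv_fin x : a <= x <= b -> TV a x \is a fin_num.
Proof.
have [d d0 hd] := tv_family_le ltr01.
have small u v : a <= u -> u <= v -> v <= b -> v - u < d -> (TV u v <= 1)%E.
  move=> au; rewrite le_eqVlt => /predU1P[<- _ _|uv vb uvd].
    by rewrite total_variationxx lee_fin.
  have := hd [:: (u, v)]; rewrite /total_length !big_seq1; apply => //.
  by rewrite /disjoint_intervals /= au uv vb.
have [n hn] : exists n, (b - a) / n.+1%:R < d.
  exists (Num.bound ((b - a) / d)); rewrite ltr_pdivrMr//.
  have t0 : 0 <= (b - a) / d by rewrite divr_ge0 ?subr_ge0// ltW.
  rewrite mulrC -ltr_pdivrMr//; apply: lt_le_trans (archi_boundP t0) _.
  by rewrite ler_nat.
have n0 : 0 < n.+1%:R :> R by [].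
pose u k := a + (b - a) * (k%:R / n.+1%:R).
have um k : u k <= u k.+1.
  rewrite /u lerD2l ler_wpM2l ?subr_ge0// ler_pM2r ?invr_gt0// ler_nat.
  exact: leqnSn.
have au k : a <= u k by rewrite /u lerDl mulr_ge0 ?subr_ge0// divr_ge0.
have ub k : (k <= n.+1)%N -> u k <= b.
  move=> kn; rewrite /u -lerBrDl ler_piMr ?subr_ge0// ler_pdivrMr// mul1r.
  by rewrite ler_nat.
have bnd k : (k <= n.+1)%N -> (TV a (u k) <= k%:R%:E)%E.
  elim: k => [_|k IH kn].
    by rewrite /u mul0r mulr0 addr0 total_variationxx.
  rewrite (total_variationD g (au k) (um k)) -natr1 EFinD.
  apply: leeD; first exact/IH/ltnW.
  apply: small => //; first exact: ub.
  apply: le_lt_trans hn; rewrite /u -natr1 le_eqVlt; apply/orP; left; apply/eqP.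
  by field; rewrite gt_eqF.
have unb : u n.+1 = b by rewrite /u divff ?gt_eqF// mulr1 addrC subrK.
move=> /andP[ax xb]; have := bnd _ (leqnn n.+1); rewrite unb => h.
rewrite ge0_fin_numE ?total_variation_ge0//; apply: le_lt_trans (ltry n.+1%:R).
apply: le_trans h; rewrite (total_variationD g ax xb) leeDl//.
exact: total_variation_ge0.
Qed.

(** Extends the variation to a monotone function on the whole line, constant outside [a, b], as a
    Lebesgue-Stieltjes measure requires. *)
Definition clamp x := Num.max a (Num.min x b).
Definition variation_fun x := fine (TV a (clamp x)).

Let clamp_in x : a <= clamp x <= b.
Proof. by rewrite /clamp le_max lexx ge_max ab ge_min lexx orbT. Qed.

Let clamp_id x : a <= x <= b -> clamp x = x.
Proof. by move=> /andP[ax xb]; rewrite /clamp (min_idPl xb) (max_idPr ax). Qed.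

Let clamp_mono x y : x <= y -> clamp x <= clamp y.
Proof. by move=> xy; rewrite /clamp le_max2// le_min2. Qed.

Let variation_funB x y : x <= y ->
  (variation_fun y - variation_fun x)%:E = TV (clamp x) (clamp y).
Proof.
move=> xy; have /andP[ax xb] := clamp_in x.
rewrite EFinB /variation_fun !fineK ?tv_fin//.
rewrite (total_variationD g ax (clamp_mono xy)) addeAC subee ?add0e//.
by rewrite tv_fin.
Qed.

Lemma variation_fun_nondecreasing : nondecreasing variation_fun.
Proof.
move=> x y xy; rewrite -subr_ge0 -lee_fin variation_funB//.
by apply: total_variation_ge0; exact: clamp_mono.
Qed.

Lemma variation_fun_ge x y : a <= x -> x <= y -> y <= b ->
  `|g y - g x| <= variation_fun y - variation_fun x.
Proof.
move=> ax xy yb; rewrite -lee_fin variation_funB// !clamp_id ?ax ?(le_trans ax)//.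
  exact: total_variation_ge.
by rewrite (le_trans xy).
Qed.

Lemma variation_fun_ac e : 0 < e -> exists2 d : R, 0 < d &
  forall s, disjoint_intervals a b s -> total_length s < d ->
    \sum_(p <- s) (variation_fun p.2 - variation_fun p.1) <= e.
Proof.
move=> /tv_family_le[d d0 hd]; exists d => // s ds ls.
rewrite -lee_fin -sumEFin; apply: le_trans (hd s ds ls).
rewrite le_eqVlt; apply/orP; left; apply/eqP; apply: eq_big_seq => p ps.
have /and3P[ap p12 pb] : [&& a <= p.1, p.1 < p.2 & p.2 <= b].
  by case/andP: ds => /allP /(_ _ ps).
rewrite variation_funB ?ltW// !clamp_id//; apply/andP; split => //.
  by rewrite (le_trans ap)// ltW.
by rewrite (le_trans (ltW p12)).
Qed.

Lemma variation_fun_continuous x e : 0 < e -> exists2 d : R, 0 < d &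
  forall y, `|y - x| < d -> `|variation_fun y - variation_fun x| <= e.
Proof.
move=> e0; have [d d0 hd] := variation_fun_ac e0; exists d => // y yx.
have key u v : u <= v -> v - u < d -> variation_fun v - variation_fun u <= e.
  move=> uv uvd; have := clamp_mono uv; rewrite le_eqVlt => /predU1P[E|cuv].
    by rewrite /variation_fun E subrr ltW.
  have cE z : variation_fun (clamp z) = variation_fun z.
    by rewrite /variation_fun (clamp_id (clamp_in z)).
  have := hd [:: (clamp u, clamp v)]; rewrite /total_length !big_seq1 /= !cE.
  have /andP[au _] := clamp_in u; have /andP[_ vb] := clamp_in v.
  apply; first by rewrite /disjoint_intervals /= au cuv vb.
  apply: le_lt_trans uvd; rewrite /clamp.
  rewrite maxEle maxEle !minEle.
  by do ?case: ifPn; rewrite -?ltNge => *; lra.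
have [xy|/ltW yx'] := leP x y.
  rewrite ger0_norm ?subr_ge0 ?variation_fun_nondecreasing//.
  by apply: key => //; move: yx; rewrite ger0_norm ?subr_ge0.
rewrite distrC ger0_norm ?subr_ge0 ?variation_fun_nondecreasing//.
by apply: key => //; move: yx; rewrite distrC ger0_norm ?subr_ge0.
Qed.

End VariationMajorant.

Lemma open_interval_segment (R : realType) (a b : R) (O : set R) : open O ->
  is_interval O -> O `<=` `]a, b[ -> O = set0 \/
  exists x y, [/\ a <= x, x < y, y <= b & O = `]x, y[%classic].
Proof.
move=> oO iO Oab; have [->|/set0P O0] := eqVneq O set0; first by left.
right; have Oin z : O z -> a < z < b by move=> /Oab; rewrite /= in_itv.
have lbO : has_lbound O by exists a => z /Oin /andP[/ltW].
have ubO : has_ubound O by exists b => z /Oin /andP[_ /ltW].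
have oO' z : O z -> exists2 d : R, 0 < d & forall t, `|t - z| < d -> O t.
  move=> Oz; have /nbhs_ballP[d /= d0 hd] := oO _ Oz.
  exists d => // t tz; apply: hd; by rewrite -ball_normE/= distrC.
have inO z : O z -> inf O < z < sup O.
  move=> Oz; have [d d0 hd] := oO' z Oz; apply/andP; split.
    apply: (@le_lt_trans _ _ (z - d / 2)); last lra.
    by apply: ge_inf => //; apply: hd; rewrite ltr_norml; lra.
  apply: (@lt_le_trans _ _ (z + d / 2)); first lra.
  by apply: ub_le_sup => //; apply: hd; rewrite ltr_norml; lra.
exists (inf O), (sup O); split.
- by apply: lb_le_inf => // z /Oin /andP[/ltW].
- by have [z /inO /andP[h1 h2]] := O0; exact: lt_trans h1 h2.
- by apply: ge_sup => // z /Oin /andP[_ /ltW].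
apply/seteqP; split => z; first by move=> /inO; rewrite /= in_itv.
rewrite /= in_itv/= => /andP[h1 h2].
have [y Oy yz] : exists2 y, O y & y < z by exact: inf_lt.
have [x Ox zx] : exists2 x, O x & z < x by exact: sup_gt.
by apply: (iO y x) => //; rewrite !ltW.
Qed.

(** * Radon-Nikodym density of a Lebesgue-Stieltjes measure *)

Section Density.
Variables (R : realType) (a b : R) (G : R -> R).
Hypothesis G_nd : nondecreasing G.
Hypothesis G_cont : forall x e : R, 0 < e -> exists2 d : R, 0 < d &
  forall y, `|y - x| < d -> `|G y - G x| <= e.
Hypothesis G_ac : forall e : R, 0 < e -> exists2 d : R, 0 < d &
  forall s, disjoint_intervals a b s -> total_length s < d ->
    \sum_(p <- s) (G p.2 - G p.1) <= e.

Let G_rc : right_continuous G.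
Proof.
apply: right_continuousW => x; apply/cvgrPdist_le => e e0.
have [d d0 hd] := G_cont x e0; apply/nbhs_ballP; exists d => //= y xy.
by rewrite distrC; apply: hd; rewrite distrC.
Qed.

Let Gc : cumulative R R := HB.pack G (isCumulative.Build R _ R G G_nd G_rc).
Let nu : {measure set (measurableTypeR R) -> \bar R} := lebesgue_stieltjes_measure Gc.
Let mu : {measure set (measurableTypeR R) -> \bar R} := @lebesgue_measure R.

Let nu_itv x y : x <= y -> nu `]x, y]%classic = (G y - G x)%:E.
Proof.
move=> xy; rewrite /nu /= /lebesgue_stieltjes_measure /measure_extension.
rewrite measurable_mu_extE/=; last exact: is_ocitv.
by rewrite wlength_itv_bnd.
Qed.

Let nu_set1 x : nu [set x] = 0%E.
Proof.
apply/eqP; rewrite eq_le measure_ge0 andbT; apply/lee_addgt0Pr => e e0.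
rewrite add0e; have [d d0 hd] := G_cont x e0.
have xd : x - d / 2 <= x by lra.
apply: (@le_trans _ _ (nu `]x - d / 2, x]%classic)).
  have m1 : measurable ([set x] : set (measurableTypeR R)) by exact: measurable_set1.
  have m2 : measurable (`]x - d / 2, x]%classic : set (measurableTypeR R)).
    exact: measurable_itv.
  apply: le_measure; rewrite ?inE// => _ ->.
  by rewrite /= in_itv/=; lra.
rewrite nu_itv// lee_fin; apply: le_trans (ler_norm _) _; rewrite distrC.
by apply: hd; rewrite ltr_norml; lra.
Qed.

(** Outer regularity encloses A in an open U of Lebesgue measure below d. Finitely many components
    of U in ]a, b[ form a family for [G_ac], so their nu-measures add up to at most e, and the
    countable sum is a limit of such sums. *)
Let nu_null A : measurable A -> mu A = 0%E -> nu (A `&` `]a, b]) = 0%E.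
Proof.
move=> mA A0; apply/eqP; rewrite eq_le measure_ge0 andbT.
apply/lee_addgt0Pr => e e0; rewrite add0e.
have [d d0 hd] := G_ac e0.
have Aoo : (mu A < +oo)%E by rewrite A0.
have [U [oU AU muUA]] := lebesgue_regularity_outer mA Aoo d0.
pose O := U `&` `]a, b[.
have oO : open O by apply: openI => //; exact: interval_open.
have mO : measurable O by exact: open_measurable.
have muO : (mu O < d%:E)%E.
  apply: le_lt_trans muUA.
  have mU : measurable U by exact: open_measurable.
  apply: (@le_trans _ _ (mu U)).
    by apply: le_measure; rewrite ?inE//; exact: subIsetl.
  have UE : U = (U `\` A) `|` A by rewrite setUC setDUK.
  rewrite [X in (mu X <= _)%E]UE; apply: le_trans (measureU2 _ _ _) _ => //.
    exact: measurableD.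
  by rewrite [X in (_ + X <= _)%E]A0 adde0.
have mb : measurable ([set b] : set (measurableTypeR R)) by exact: measurable_set1.
have mab : measurable (`]a, b]%classic : set (measurableTypeR R)) by exact: measurable_itv.
(* O lies in the open interval, so the endpoint b of ]a, b] is added separately; it is not an
   atom. *)
apply: (@le_trans _ _ (nu (O `|` [set b]))).
  apply: le_measure; rewrite ?inE.
  - exact: measurableI.
  - exact: measurableU.
  move=> x [/AU Ux]; rewrite /= in_itv/= => /andP[ax].
  rewrite le_eqVlt => /predU1P[->|xb]; first by right.
  by left; split => //; rewrite /= in_itv/= ax.
apply: le_trans (measureU2 _ _ _) _ => //.
rewrite [X in (_ + X <= _)%E]nu_set1 adde0.
pose I := open_disjoint_itv oO.
have mI i : measurable (I i).
  by apply: open_measurable; exact: open_disjoint_itv_open.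
have tI : trivIset setT I by exact: open_disjoint_itv_trivIset.
have OI : O = \bigcup_q I q by exact: open_disjoint_itv_bigcup.
have Iab i : I i `<=` `]a, b[.
  by move=> x Ix; have [] : O x by rewrite OI; exists i.
have IP i : I i = set0 \/ exists x y, [/\ a <= x, x < y, y <= b & I i = `]x, y[%classic].
  apply: open_interval_segment => //; first exact: open_disjoint_itv_open.
  exact: open_disjoint_itv_is_interval.
have mUI : measurable (\bigcup_q I q) by rewrite -OI.
have sum_O (m : {measure set (measurableTypeR R) -> \bar R}) :
    m O = (\sum_(i <oo) m (I i))%E.
  by transitivity (m (\bigcup_q I q)); [rewrite -OI|exact: measure_semi_bigcup].
suff : (nu O <= e%:E)%E by [].
rewrite (sum_O nu).
apply: lime_le; first by apply: is_cvg_nneseries => n _ _; exact: measure_ge0.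
apply: nearW => n.
(* Empty components are left out of [s], whose members must be proper intervals. *)
have [s [ds sI snu smu]] : exists s, [/\ disjoint_intervals a b s,
   forall p, p \in s -> exists2 i, (i < n)%N & I i = `]p.1, p.2[%classic,
   (\sum_(0 <= i < n) nu (I i) <= (\sum_(p <- s) (G p.2 - G p.1))%:E)%E &
   (\sum_(0 <= i < n) mu (I i) = (total_length s)%:E)%E].
  elim: n => [|n [s [/andP[als pws] sI snu smu]]].
    by exists [::]; split; rewrite /total_length ?big_nil ?big_geq.
  rewrite !big_nat_recr//=.
  have [I0|[x [y [ax xy yb IE]]]] := IP n.
    exists s; split.
    - by rewrite /disjoint_intervals als.
    - by move=> p /sI[i ni ?]; exists i => //; rewrite ltnS ltnW.
    - by rewrite I0 measure0 adde0.
    - by rewrite I0 measure0 adde0.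
  exists ((x, y) :: s); split.
  - apply/andP; split; first by rewrite /= ax xy yb.
    rewrite /= pws andbT; apply/allP => -[u v] /[dup] /sI[i ni /= IiE] /(allP als)/= /and3P[_ uv _].
    have /trivIsetP/(_ i n Logic.I Logic.I) := tI; rewrite ltn_eqF// => /(_ isT).
    rewrite IiE IE => /seteqP[h _]; rewrite leNgt [_ <= x]leNgt -negb_and.
    apply/negP => /andP[uy xv]; pose l := Num.max u x; pose r := Num.min v y.
    have lr : l < r by rewrite gt_max !lt_min uv uy xv xy.
    apply: (h ((l + r) / 2)); have : u <= l by rewrite le_max lexx.
    have : x <= l by rewrite le_max lexx orbT.
    have : r <= v by rewrite ge_min lexx.
    have : r <= y by rewrite ge_min lexx orbT.
    by split; rewrite /= in_itv/=; lra.
  - move=> p; rewrite inE => /predU1P[->|/sI[i ni ?]]; first by exists n.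
    by exists i => //; rewrite ltnS ltnW.
  - have : (nu `]x, y[%classic <= nu `]x, y]%classic)%E.
      by apply: le_measure; rewrite ?inE//; apply: subset_itvl; rewrite bnd_simp.
    rewrite (nu_itv (ltW xy)) -IE => h.
    by rewrite big_cons EFinD addeC; apply: leeD.
  - rewrite /total_length big_cons EFinD smu addeC IE /mu lebesgue_measure_itv/=.
    by rewrite lte_fin xy.
apply: le_trans snu _; rewrite lee_fin; apply: hd => //.
rewrite -lte_fin -smu; apply: le_lt_trans muO.
rewrite (sum_O mu).
by apply: nneseries_lim_ge => // k _; exact: measure_ge0.
Qed.

(** Restricted to ]a, b], nu is finite, and by [nu_null] it is dominated by the Lebesgue measure, so
    Radon-Nikodym applies. *)
Lemma density_of_nondecreasing_ac : a <= b -> exists f : R -> R,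
  [/\ measurable_fun setT f, forall x, 0 <= f x,
      (@lebesgue_measure R).-integrable setT (EFin \o f) &
      forall t u, a <= t -> t <= u -> u <= b ->
        G u - G t = \int[@lebesgue_measure R]_(x in `[t, u]) f x].
Proof.
move=> ab.
have mab : measurable (`]a, b]%classic : set (measurableTypeR R)) by exact: measurable_itv.
have nuab : (nu `]a, b]%classic < +oo)%E by rewrite nu_itv// ltry.
have dom : mfrestr mab nuab `<< @lebesgue_measure R.
  apply/null_content_dominatesP => A mA A0; exact: nu_null.
have [f [f0 ffin fint fE]] : exists f : R -> \bar R, [/\ forall x, (0 <= f x)%E,
    forall x, f x \is a fin_num, (@lebesgue_measure R).-integrable setT f &
    forall A : set (measurableTypeR R), measurable A ->
      nu (A `&` `]a, b]) = (\int[@lebesgue_measure R]_(x in A) f x)%E].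
  exact: radon_nikodym_sigma_finite dom.
have mf : measurable_fun setT f by exact: measurable_int fint.
have fineE : EFin \o (fine \o f) = f.
  by apply/funext => x /=; rewrite fineK.
exists (fine \o f); split.
- by apply: measurableT_comp => //; exact: measurable_fine.
- by move=> x; exact: fine_ge0.
- by rewrite fineE.
move=> t u at_ tu ub.
have mtu : measurable (`]t, u]%classic : set (measurableTypeR R)) by exact: measurable_itv.
have inttu : (@lebesgue_measure R).-integrable `]t, u] (EFin \o (fine \o f)).
  by rewrite fineE; apply: integrableS fint.
rewrite -Rintegral_itv_obnd_cbnd// /Rintegral.
have -> : (\int[@lebesgue_measure R]_(x in `]t, u]) (EFin \o (fine \o f)) x)%E = (G u - G t)%:E.
  rewrite fineE -fE//.
  rewrite (_ : _ `&` _ = `]t, u]%classic) ?nu_itv//.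
  apply/seteqP; split => x; first by case.
  rewrite /= !in_itv/= => /andP[tx xu]; split; first by rewrite tx.
  by rewrite (le_lt_trans at_)//= (le_trans xu).
by [].
Qed.

End Density.

Lemma abs_continuous_density (R : realType) (a b : R) (g : R -> R) : a <= b ->
  abs_continuous a b g -> exists f : R -> R,
  [/\ measurable_fun setT f, forall x, 0 <= f x,
      (@lebesgue_measure R).-integrable setT (EFin \o f) &
      forall t u, a <= t -> t <= u -> u <= b ->
        `|g u - g t| <= \int[@lebesgue_measure R]_(x in `[t, u]) f x].
Proof.
move=> ab acg.
have [f [mf f0 intf fE]] := density_of_nondecreasing_ac
  (variation_fun_nondecreasing ab acg) (variation_fun_continuous ab acg)
  (variation_fun_ac ab acg) ab.
exists f; split => // t u at_ tu ub; rewrite -fE//.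
exact: variation_fun_ge.
Qed.

(** * Evolution families *)

Section LocalBounds.
Variable R : realType.
Implicit Types (a b x y e : R) (g : R -> R).

Lemma abs_continuous_eps_cont a b g : abs_continuous a b g -> eps_cont a b g.
Proof.
move=> acg x hx e e0; have e20 : 0 < e / 2 by lra.
have [d d0 hd] := abs_continuous_seq acg e20.
have key u v : a <= u -> u < v -> v <= b -> v - u < d -> `|g v - g u| <= e / 2.
  move=> au uv vb uvd; have := hd [:: (u, v)].
  rewrite /total_length /total_increment !big_seq1; apply => //.
  by rewrite /disjoint_intervals /= au uv vb.
exists d => // y hy yxd; apply: (@le_lt_trans _ _ (e / 2)); last lra.
have [yx|xy|->] := ltgtP y x; last by rewrite subrr normr0 ltW.
  rewrite distrC; apply: key; [lra|by []|lra|].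
  by apply: le_lt_trans yxd; rewrite distrC; exact: ler_norm.
apply: key; [lra|by []|lra|].
by apply: le_lt_trans yxd; exact: ler_norm.
Qed.

Lemma eps_cont_le_max a b g : a <= b -> eps_cont a b g ->
  exists M, forall x, a <= x <= b -> g x <= M.
Proof.
move=> ab /eps_cont_within cg; have [c _ hc] := EVT_max ab cg.
by exists (g c) => x hx; apply: hc; rewrite in_itv.
Qed.

Lemma eps_cont_gt0_min a b g : a <= b -> eps_cont a b g ->
  (forall x, a <= x <= b -> 0 < g x) ->
  exists2 m : R, 0 < m & forall x, a <= x <= b -> m <= g x.
Proof.
move=> ab /eps_cont_within cg g0; have [c cab hc] := EVT_min ab cg.
exists (g c); first by apply: g0; move: cab; rewrite in_itv.
by move=> x hx; apply: hc; rewrite in_itv.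
Qed.

End LocalBounds.

(** Both errors carry an increment: a1 / a0 - 1 = (a1 - a0) / a0, and b1 - (a1 / a0) b0 = (b1 - b0)
    - (a1 - a0) b0 / a0. The bounds m, B and Z make the constant uniform. *)
Lemma near_linear_bound (R : realType) (a0 a1 b0 b1 m B Z : R) (y v : R[i]) :
  0 < m -> m <= a0 -> `|b0| <= B -> cmod y <= Z ->
  cmod (v - real_complex R (a1 / a0) * y) <=
    `|b1 - a1 / a0 * b0| / a0 ^+ 2 / 2 * cmod y ^+ 2 ->
  cmod (v - y) <=
    (Z / m + (1 + B / m) / m ^+ 2 / 2 * Z ^+ 2) * (`|a1 - a0| + `|b1 - b0|).
Proof.
move=> m0 ma bB yZ hv; have a00 : 0 < a0 by exact: lt_le_trans ma.
have im : a0^-1 <= m^-1 by rewrite lef_pV2.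
have im0 : 0 <= a0^-1 by rewrite invr_ge0 ltW.
have y0 := cmod_ge0 y; have Z0 := le_trans y0 yZ.
have B0 : 0 <= B by apply: le_trans bB.
have Bm0 : 0 <= B / m by rewrite divr_ge0// ltW.
have Zm0 : 0 <= Z / m by rewrite divr_ge0// ltW.
have vE : v - y = (v - real_complex R (a1 / a0) * y) +
    real_complex R ((a1 - a0) / a0) * y.
  have -> : (a1 - a0) / a0 = a1 / a0 - 1 by rewrite mulrBl divff// gt_eqF.
  by rewrite rmorphB/= rmorph1; ring.
have baE : b1 - a1 / a0 * b0 = (b1 - b0) - (a1 - a0) * (a0^-1 * b0).
  by field; rewrite gt_eqF.
rewrite vE; apply: le_trans (cmodD _ _) _; rewrite cmodM cmod_real normrM normfV (gtr0_norm a00).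
rewrite baE in hv; move: hv.
have : 0 <= `|a1 - a0| by []. have : 0 <= `|b1 - b0| by [].
have : `|b1 - b0 - (a1 - a0) * (a0^-1 * b0)| <=
    `|b1 - b0| + `|a1 - a0| * (a0^-1 * `|b0|).
  by apply: le_trans (ler_normB _ _) _; rewrite !normrM normfV (gtr0_norm a00).
move: `|a1 - a0| `|b1 - b0| `|_ - _ * _| => da db n hn db0 da0 hv.
have h1 : da / a0 * cmod y <= Z / m * da.
  rewrite -mulrA [leRHS]mulrC; apply: ler_wpM2l => //.
  by rewrite mulrC; exact: ler_pM.
have hb : a0^-1 * `|b0| <= B / m by rewrite mulrC; exact: ler_pM.
have hnK : n <= (1 + B / m) * (da + db) by apply: le_trans hn _; nra.
have h2 : n / a0 ^+ 2 / 2 * cmod y ^+ 2 <=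
    ((1 + B / m) * (da + db)) / m ^+ 2 / 2 * Z ^+ 2.
  have n0 : 0 <= (1 + B / m) * (da + db) by rewrite mulr_ge0 ?addr_ge0.
  apply: (@le_trans _ _ ((1 + B / m) * (da + db) / a0 ^+ 2 / 2 * cmod y ^+ 2)).
    by rewrite ler_wpM2r ?sqr_ge0// ler_pM2r// ler_wpM2r// invr_ge0 sqr_ge0.
  apply: ler_pM; rewrite ?sqr_ge0 ?divr_ge0 ?sqr_ge0//; last by rewrite lerXn2r ?nnegrE.
  rewrite ler_pM2r//; apply: ler_wpM2l => //.
  by rewrite lef_pV2 ?posrE ?exprn_gt0// lerXn2r ?nnegrE ?(ltW m0) ?(ltW a00).
apply: le_trans (lerD hv h1) _; apply: le_trans (lerD h2 (lexx _)) _.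
rewrite [leRHS](_ : _ = (1 + B / m) * (da + db) / m ^+ 2 / 2 * Z ^+ 2 + Z / m * (da + db)); last by ring.
by rewrite lerD2l; apply: ler_wpM2l => //; lra.
Qed.

Section Evolution.
Variables (R : realType) (I : set R) (w : R -> R -> R[i] -> R[i]).
Hypothesis hI : time_interval I.
Hypothesis hBF : forall s t, Delta I (s, t) -> BF (w s t).
Hypothesis hcomp : forall s t u, I s -> I t -> I u -> s <= t -> t <= u ->
  forall z, half_plane z -> w s u z = w t u (w s t z).
Hypothesis hzero : forall t, I t -> deriv_at0 0 (w 0 t) = 0%E.
Hypothesis hfin : forall t, I t -> deriv_at0 1 (w 0 t) \is a fin_num /\
  deriv_at0 2 (w 0 t) \is a fin_num.
Hypothesis hAC1 : AC_loc I (fun t => fine (deriv_at0 1 (w 0 t))).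
Hypothesis hAC2 : AC_loc I (fun t => fine (deriv_at0 2 (w 0 t))).
Implicit Types (s t u b : R).
Local Open Scope complex_scope.
Let al t : R := fine (deriv_at0 1 (w 0 t)).
Let be t : R := fine (deriv_at0 2 (w 0 t)).

Lemma time_interval_ge0 t : I t -> 0 <= t.
Proof.
case: hI => [[T T0 []]|] ->; rewrite /= in_itv/=; [by case/andP|by case/andP|].
by rewrite andbT.
Qed.

Lemma time_interval_down s t : I t -> 0 <= s -> s <= t -> I s.
Proof.
case: hI => [[T T0 []]|] ->; rewrite /= !in_itv/=.
- by move=> /andP[_ tT] -> /le_trans; apply.
- by move=> /andP[_ tT] -> /le_lt_trans; apply.
- by rewrite !andbT.
Qed.

Let al_gt0 t : I t -> 0 < al t.
Proof.
move=> It; have I0 := time_interval_down It (lexx 0) (time_interval_ge0 It).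
apply: BF_deriv_at0_gt0; [|exact: hzero|by case: (hfin It)].
by apply: hBF; split => //=; exact: time_interval_ge0.
Qed.

Lemma evolution_half_plane s t z : I s -> I t -> s <= t -> half_plane z ->
  half_plane (w s t z).
Proof. by move=> Is It st; apply: BF_Re_gt0; exact: hBF. Qed.

(** [BF_comp_le] for w_{0,t} as w_{s,t} after w_{0,s}; it keeps orbits bounded over compact time
    intervals. *)
Let step_le s t z : I s -> I t -> s <= t -> half_plane z ->
  cmod (w s t z) <= al t / al s * cmod z.
Proof.
move=> Is It st z0; have s0 := time_interval_ge0 Is; have t0 := time_interval_ge0 It.
have I0 := time_interval_down It (lexx 0) t0.
have [f1 _] := hfin Is; have [f3 _] := hfin It.
apply: (@BF_comp_le _ (w 0 s) (w s t) (w 0 t)) => //.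
- exact: hBF.
- exact: hBF.
- exact: hBF.
- by move=> y y0; apply: hcomp.
- exact: hzero.
- exact: hzero.
Qed.

Let step_near t u z : I t -> I u -> t <= u -> half_plane z ->
  cmod (w t u z - (al u / al t)%:C * z) <=
    `|be u - al u / al t * be t| / al t ^+ 2 / 2 * cmod z ^+ 2.
Proof.
move=> Is It st z0; have s0 := time_interval_ge0 Is; have t0 := time_interval_ge0 It.
have I0 := time_interval_down It (lexx 0) t0.
have [f1 g1] := hfin Is; have [f3 g3] := hfin It.
apply: (@BF_comp_near _ (w 0 t) (w t u) (w 0 u)) => //.
- exact: hBF.
- exact: hBF.
- exact: hBF.
- by move=> y y0; apply: hcomp.
- exact: hzero.
- exact: hzero.
Qed.

(** On [0, b] continuity gives 0 < m <= al <= M and |be| <= Mb. By [step_le] the point w_{s,t}(z)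
    has modulus at most Z = (M / m) |z|, and [near_linear_bound] is applied to w_{t,u} there. *)
Lemma evolution_lipschitz b z : I b -> half_plane z -> exists2 C : R, 0 <= C &
  forall s t u, 0 <= s -> s <= t -> t <= u -> u <= b ->
    cmod (w s u z - w s t z) <= C * (`|al u - al t| + `|be u - be t|).
Proof.
move=> Ib z0; have b0 := time_interval_ge0 Ib.
have sub : `[0, b] `<=` I.
  by move=> x; rewrite /= in_itv/= => /andP[x0 xb]; exact: time_interval_down Ib _ _.
have ca : eps_cont 0 b al by apply: abs_continuous_eps_cont; exact: hAC1.
have cb : eps_cont 0 b be by apply: abs_continuous_eps_cont; exact: hAC2.
have inI x : 0 <= x <= b -> I x by move=> /andP[]; exact: time_interval_down Ib.
have [m m0 hm] := eps_cont_gt0_min b0 ca (fun x hx => al_gt0 (inI x hx)).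
have [M hM] := eps_cont_le_max b0 ca.
have cbn : eps_cont 0 b (fun x => `|be x|).
  move=> x hx e e0; have [d d0 hd] := cb x hx e e0; exists d => // y hy yx.
  exact: le_lt_trans (ler_dist_dist _ _) (hd y hy yx).
have [Mb hMb] := eps_cont_le_max b0 cbn.
have M0 : 0 < M by apply: lt_le_trans (hM 0 _); [apply/al_gt0/inI|]; rewrite lexx.
have Mb0 : 0 <= Mb by apply: le_trans (hMb 0 _); rewrite ?lexx.
pose Z := M / m * cmod z.
have Z0 : 0 <= Z by rewrite mulr_ge0 ?cmod_ge0// divr_ge0// ltW.
pose K := (1 + Mb / m) / m ^+ 2 / 2 * Z ^+ 2.
have K0 : 0 <= K.
  rewrite mulr_ge0 ?sqr_ge0// !divr_ge0 ?sqr_ge0// addr_ge0// divr_ge0//.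
  exact: ltW.
exists (Z / m + K); first by rewrite addr_ge0// divr_ge0// ltW.
move=> s t u s0 st tu ub.
have t0 : 0 <= t by lra.
have hs : 0 <= s <= b by lra.
have ht : 0 <= t <= b by lra.
have hu : 0 <= u <= b by lra.
have Is := inI s hs; have It := inI t ht; have Iu := inI u hu.
rewrite (hcomp Is It Iu st tu z0); set y := w s t z.
have y0 : half_plane y by exact: evolution_half_plane.
have yZ : cmod y <= Z.
  apply: le_trans (step_le Is It st z0) _; apply: ler_wpM2r; first exact: cmod_ge0.
  apply: ler_pM; rewrite ?invr_ge0 ?(ltW (al_gt0 _))//; first exact: hM.
  by rewrite lef_pV2 ?posrE ?al_gt0// hm.
have mt := hm t ht.
exact: (near_linear_bound m0 mt (hMb t ht) yZ (step_near It Iu tu y0)).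
Qed.

Lemma evolution_density b z : I b -> half_plane z -> exists f : R -> R,
  [/\ measurable_fun setT f, forall x, 0 <= f x,
      (@lebesgue_measure R).-integrable setT (EFin \o f) &
      forall s t u, 0 <= s -> s <= t -> t <= u -> u <= b ->
        cmod (w s u z - w s t z) <= \int[@lebesgue_measure R]_(x in `[t, u]) f x].
Proof.
move=> Ib z0; have b0 := time_interval_ge0 Ib.
have sub : `[0, b] `<=` I.
  by move=> x; rewrite /= in_itv/= => /andP[x0 xb]; exact: time_interval_down Ib _ _.
have [C C0 hC] := evolution_lipschitz Ib z0.
have [f1 [mf1 f10 if1 h1]] := abs_continuous_density b0 (hAC1 b0 sub).
have [f2 [mf2 f20 if2 h2]] := abs_continuous_density b0 (hAC2 b0 sub).
have if12 : (@lebesgue_measure R).-integrable setT (EFin \o (f1 \+ f2)).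
  by have := integrableD measurableT if1 if2.
exists (fun x => C * (f1 x + f2 x)); split.
- by apply: measurable_funM => //; exact: measurable_funD.
- by move=> x; rewrite mulr_ge0// addr_ge0.
- by have := integrableZl measurableT C if12.
move=> s t u s0 st tu ub; apply: le_trans (hC s t u s0 st tu ub) _.
have mtu : measurable (`[t, u]%classic : set R) by exact: measurable_itv.
rewrite RintegralZl//; last by apply: integrableS if12.
apply: ler_wpM2l => //; rewrite RintegralD//; last 2 first.
- by apply: integrableS if1.
- by apply: integrableS if2.
by apply: lerD; [apply: h1|apply: h2] => //; lra.
Qed.

End Evolution.

(** * Gluing densities along an exhaustion *)

Section Gluing.
Variables (R : realType) (T : nat -> R) (F : nat -> R -> R).
Hypothesis T_nd : forall n, T n <= T n.+1.
Hypothesis F_meas : forall n, measurable_fun setT (F n).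
Hypothesis F_ge0 : forall n r, 0 <= F n r.
Hypothesis F_int : forall n, (@lebesgue_measure R).-integrable setT (EFin \o F n).

Let T_mono n m : (n <= m)%N -> T n <= T m.
Proof.
move=> /subnKC <-; elim: (m - n)%N => [|k IH]; first by rewrite addn0.
by rewrite addnS; exact: le_trans IH (T_nd _).
Qed.

Let piece n : set R := `[T n, T n.+1[%classic.

Let piece_inj n m r : piece n r -> piece m r -> n = m.
Proof.
wlog nm : n m / (n < m)%N.
  move=> H rn rm; case: (ltngtP n m) => // h; first exact: H.
  exact/esym/H.
rewrite /piece /= !in_itv/= => /andP[_ rn] /andP[mr _].
by have := T_mono nm; rewrite leNgt (le_lt_trans mr rn).
Qed.

Definition glue r : R :=
  if pselect (exists n, piece n r) is left h then F (sval (cid h)) r else 0.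

Lemma glueE n r : T n <= r < T n.+1 -> glue r = F n r.
Proof.
move=> hr; have pr : piece n r by rewrite /piece /= in_itv.
rewrite /glue; case: pselect => [h|]; last by move=> []; exists n.
by case: cid => m /= pm; rewrite (piece_inj pm pr).
Qed.

Lemma glue_ge0 r : 0 <= glue r.
Proof. by rewrite /glue; case: pselect. Qed.

Lemma measurable_glue : measurable_fun (\bigcup_n `[T n, T n.+1[) glue.
Proof.
apply/measurable_fun_bigcup; first by move=> n; exact: measurable_itv.
move=> n; apply: (eq_measurable_fun (F n)).
  by move=> r; rewrite inE /= in_itv/= => /glueE.
exact: measurable_funTS.
Qed.

Lemma piece_of n r : T 0 <= r -> r < T n -> exists2 k, (k < n)%N & T k <= r < T k.+1.
Proof.
elim: n => [|n IH] r0 rn; first by move: r0; rewrite leNgt rn.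
have [/IH[]//|nr] := ltP r (T n); last by exists n; rewrite ?nr.
by move=> k kn rk; exists k => //; exact: ltnW.
Qed.

(** Before T n, [glue] agrees at each point with one of the first n functions, so their sum
    dominates it. *)
Lemma integrable_glue n : (@lebesgue_measure R).-integrable `[T 0, T n[ (EFin \o glue).
Proof.
pose S r := \sum_(k < n) F k r.
have iS : (@lebesgue_measure R).-integrable setT (EFin \o S).
  have -> : EFin \o S = (fun r => \sum_(k < n) (F k r)%:E)%E.
    by apply/funext => r; rewrite /= sumEFin.
  by apply: integrable_sum => // k _; exact: F_int.
have mT : measurable (`[T 0, T n[%classic : set R) by exact: measurable_itv.
have iST : (@lebesgue_measure R).-integrable `[T 0, T n[ (EFin \o S).
  exact: integrableS iS.
apply: le_integrable iST => //.
- apply/measurable_EFinP; apply: measurable_funS measurable_glue.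
    by apply: bigcup_measurable => k _; exact: measurable_itv.
  move=> r; rewrite /= in_itv/= => /andP[r0 rn].
  by have [k _ hk] := piece_of r0 rn; exists k => //; rewrite /= in_itv.
- move=> r; rewrite /= in_itv/= => /andP[r0 rn]; rewrite lee_fin.
  have [k kn hk] := piece_of r0 rn; rewrite (glueE hk).
  rewrite ger0_norm ?ger0_norm ?sumr_ge0// /S (bigD1 (Ordinal kn))//= lerDl.
  by rewrite sumr_ge0.
Qed.

Variable d : R -> R -> R.
Hypothesis d_triangle : forall t u v, t <= u -> u <= v -> d t v <= d t u + d u v.
Hypothesis d_bound : forall n t u, T 0 <= t -> t <= u -> u <= T n.+1 ->
  d t u <= \int[@lebesgue_measure R]_(x in `[t, u]) F n x.

Let glue_piece n t u : T n <= t -> t <= u -> u <= T n.+1 ->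
  \int[@lebesgue_measure R]_(x in `[t, u]) glue x =
  \int[@lebesgue_measure R]_(x in `[t, u]) F n x.
Proof.
move=> nt tu un; have mco : measurable (`[t, u[%classic : set R) by exact: measurable_itv.
have iF : (@lebesgue_measure R).-integrable `[t, u[ (EFin \o F n).
  by apply: integrableS (F_int n).
have eF : {in `[t, u[%classic, glue =1 F n}.
  by move=> r; rewrite inE /= in_itv/= => hr; apply: glueE; lra.
rewrite -!Rintegral_itv_bndo_bndc//; first exact: eq_Rintegral.
by apply: eq_integrable iF => // r /eF /= ->.
Qed.

(** Induction on the piece that contains the right end: the triangle inequality splits at T n, and
    beyond it [glue] is [F n]. The index m stays fixed and keeps [glue] integrable throughout. *)
Lemma glue_bound m t u : T 0 <= t -> t <= u -> u < T m ->
  d t u <= \int[@lebesgue_measure R]_(x in `[t, u]) glue x.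
Proof.
suff key n x y : T 0 <= x -> x <= y -> y < T m -> y <= T n ->
    d x y <= \int[@lebesgue_measure R]_(r in `[x, y]) glue r.
  by move=> t0 tu um; apply: (key m) => //; exact: ltW.
elim: n x y => [|n IH] {}t {}u t0 tu um un.
  have uE : u = T 0 by apply/eqP; rewrite eq_le un (le_trans t0).
  have tE : t = T 0 by apply/eqP; rewrite eq_le t0 -uE tu.
  by rewrite uE tE (@glue_piece 0)//; exact: d_bound.
have [unn|/ltW nlt] := leP u (T n); first exact: IH.
have [ltn|/ltW nt] := leP t (T n); last first.
  by rewrite (@glue_piece n)//; exact: d_bound.
apply: le_trans (d_triangle ltn nlt) _.
have i1 : (@lebesgue_measure R).-integrable `[t, u] (EFin \o glue).
  apply: integrableS (integrable_glue m); [exact: measurable_itv..|].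
  by apply: subset_itv; rewrite bnd_simp.
have i2 : (@lebesgue_measure R).-integrable `]T n, u] (EFin \o glue).
  apply: integrableS i1; [exact: measurable_itv..|].
  by apply: subset_itvr; rewrite bnd_simp.
have := @Rintegral_itvB R glue (BLeft t) (BRight u) (T n).
rewrite !bnd_simp => /(_ i1 ltn nlt) h.
rewrite -(subrK (\int[@lebesgue_measure R]_(x in `[t, T n]) glue x)
  (\int[@lebesgue_measure R]_(x in `[t, u]) glue x)) h [leRHS]addrC.
apply: lerD.
  by apply: IH => //; exact: le_lt_trans nlt um.
rewrite Rintegral_itv_obnd_cbnd// (@glue_piece n)//; apply: d_bound => //.
exact: le_trans t0 ltn.
Qed.

End Gluing.

Lemma half_open_exhaustion (R : realType) (I : set R) :
  (exists2 T, 0 < T & I = `[0, T[%classic) \/ I = `[0, +oo[%classic ->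
  exists T : nat -> R, [/\ T 0 = 0, forall n, T n <= T n.+1, forall n, I (T n) &
    forall t, I t -> exists n, t < T n].
Proof.
case=> [[T T0 ->]|->].
  exists (fun n => T - T / n.+1%:R); split.
  - by rewrite divr1 subrr.
  - move=> n; rewrite lerD2l lerN2 ler_pM2l// lef_pV2 ?posrE// ler_nat.
    exact: leqnSn.
  - move=> n; rewrite /= in_itv/= subr_ge0 ler_pdivrMr// ler_peMr ?ler1n ?(ltW T0)//=.
    by rewrite ltrBlDr ltrDl divr_gt0.
  - move=> t; rewrite /= in_itv/= => /andP[t0 tT].
    have tT0 : 0 < T - t by rewrite subr_gt0.
    exists (Num.bound (T / (T - t))).
    rewrite ltrBrDl -ltrBrDr ltr_pdivrMr//.
    rewrite mulrC -ltr_pdivrMr//.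
    apply: lt_le_trans (archi_boundP _) _; first by rewrite divr_ge0 ?ltW.
    by rewrite ler_nat.
exists (fun n => n%:R); split => //.
- by move=> n; rewrite ler_nat.
- by move=> n; rewrite /= in_itv/= andbT.
- move=> t; rewrite /= in_itv/= andbT => t0; exists (Num.bound t).
  exact: archi_boundP.
Qed.

Theorem theorem6 (R : realType) (I : set R) (hI : time_interval I)
    (w : R -> R -> R[i] -> R[i])
    (hBF : forall s t, Delta I (s, t) -> BF (w s t))
    (hid : forall s, I s -> forall z, half_plane z -> w s s z = z)
    (hcomp : forall s t u, I s -> I t -> I u -> s <= t -> t <= u ->
      forall z, half_plane z -> w s u z = w t u (w s t z))
    (hzero : forall t, I t -> deriv_at0 0 (w 0 t) = 0%E)
    (hfin : forall t, I t -> deriv_at0 1 (w 0 t) \is a fin_num /\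
                             deriv_at0 2 (w 0 t) \is a fin_num)
    (hAC1 : AC_loc I (fun t => fine (deriv_at0 1 (w 0 t))))
    (hAC2 : AC_loc I (fun t => fine (deriv_at0 2 (w 0 t)))) :
  ac_evolution_family I w.
Proof.
split => //.
  move=> s t st; have BFw := hBF s t st; split.
    by case: BFw => -[dw _] _ _ _; exact: dw.
  by move=> z; exact: BF_Re_gt0.
move=> z z0.
have dens b (Ib : I b) := evolution_density hI hBF hcomp hzero hfin hAC1 hAC2 Ib z0.
have norm_le (x y : R[i]) (r : R) : (`|x - y| <= real_complex R r) = (cmod (x - y) <= r).
  by rewrite normcE lecR.
(* A closed I is compact and one density serves; the half-open cases need gluing. *)
have [[T T0 IE]|Io] : (exists2 T, 0 < T & I = `[0, T]%classic) \/
    ((exists2 T, 0 < T & I = `[0, T[%classic) \/ I = `[0, +oo[%classic).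
  case: hI => [[T T0 [IE|IE]]|IE]; [left; by exists T|right; left; by exists T|].
  by right; right.
  have IT : I T by rewrite IE /= in_itv/= lexx ltW.
  have [f [mf f0 intf hf]] := dens T IT; exists f; split => //.
    split; first exact: measurable_funTS.
    by move=> a b ab _; exact: integrableS intf.
  move=> s t u Is It Iu st tu; rewrite norm_le; apply: hf => //.
    exact: (time_interval_ge0 hI).
  by move: Iu; rewrite IE /= in_itv/= => /andP[].
have [T [T0 Tnd IT exT]] := half_open_exhaustion Io.
have /choice[F FP] := fun n => dens (T n.+1) (IT n.+1).
have Fm n : measurable_fun setT (F n) by have [] := FP n.
have F0 n r : 0 <= F n r by have [_ h _ _] := FP n.
have Fi n : (@lebesgue_measure R).-integrable setT (EFin \o F n) by have [] := FP n.
have ge0 := time_interval_ge0 hI.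
have IU : I = \bigcup_n `[T n, T n.+1[%classic.
  apply/seteqP; split => t.
    move=> It; have [n tn] := exT t It.
    have [|k _ hk] := @piece_of _ T n t _ tn; first by rewrite T0 ge0.
    by exists k => //; rewrite /= in_itv.
  move=> [n _]; rewrite /= in_itv/= => /andP[nt tn].
  apply: (time_interval_down hI (IT n.+1)); last exact: ltW.
  by apply: le_trans nt; exact: ge0.
exists (glue T F); split.
- split; first by rewrite IU; exact: measurable_glue.
  move=> a b ab abI; have Ib : I b by apply: abI; rewrite /= in_itv/= ab lexx.
  have Ia : I a by apply: abI; rewrite /= in_itv/= ab lexx.
  have [n bn] := exT b Ib.
  apply: integrableS (integrable_glue Tnd Fm F0 Fi n) => //.
  by apply: subset_itv; rewrite bnd_simp// T0 ge0.
- by move=> r _; exact: glue_ge0.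
move=> s t u Is It Iu st tu; rewrite norm_le.
(* [glue_bound] requires a subadditive d for all pairs of times, whereas w_{s,x} makes sense for s
   <= x; the value 0 for x < s preserves both of its hypotheses. *)
pose d x y := if s <= x then cmod (w s y z - w s x z) else 0.
have [n un] := exT u Iu.
have -> : cmod (w s u z - w s t z) = d t u by rewrite /d st.
apply: (glue_bound Tnd Fm F0 Fi _ _ _ tu un); last by rewrite T0 ge0.
- move=> x y v xy yv; rewrite /d; case: ifPn => sx.
    rewrite (le_trans sx xy).
    have -> : w s v z - w s x z = (w s y z - w s x z) + (w s v z - w s y z) by ring.
    exact: cmodD.
  by rewrite add0r; case: ifP => // _; exact: cmod_ge0.
- move=> m x y _ xy ym; rewrite /d; case: ifPn => sx.
    by have [_ _ _ h] := FP m; apply: h => //; exact: ge0.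
  by apply: Rintegral_ge0 => r _; exact: F0.
Qed.
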